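(* Let $Q$ be a quiver without oriented $2$-cycles and $(Q,S)$ a QP such that $S$ belongs to the path algebra $R\langle A\rangle$ and the two-sided ideal $J_0$ of $R\langle A\rangle$ generated by all cyclic derivatives $\partial_aS$ ($a\in Q_1$) contains some power of the ideal generated by the arrows. Let $M$ be a finite-dimensional $\mathcal{P}(Q,S)$-module. With $\varphi$, ${\rm ev}$, $P'$, $P''$, $P^{(1)}$, $P^{(0)}$ as defined in the context (for any choice of the complements $U'_k,U''_k,M^{(0)}(k)$), the following hold. (1) For every $p'\in P'$ there exists a unique $p''\in P''$ such that $\varphi(p'-p'')\in P^{(0)}$. The map $\overline\varphi:P'\to P^{(0)}$ given by $\overline\varphi(p')=\varphi(p'-p'')$ is a $\mathcal{P}(Q,S)$-module homomorphism. (2) The restrictions of $\overline\varphi$ to $P^{(1)}$ and of ${\rm ev}$ to $P^{(0)}$ make the sequence $$P^{(1)}\xrightarrow{\ \overline\varphi\ }P^{(0)}\xrightarrow{\ {\rm ev}\ }M\to0$$ exact, thus giving a presentation of $M$. (3) This presentation is minimal, that is, the map $\overline\varphi:P^{(1)}\to P^{(0)}$ induces an isomorphism $P^{(1)}/\mathfrak{m}P^{(1)}\to\mathrm{im}(\overline\varphi)/\mathfrak{m}\,\mathrm{im}(\overline\varphi)$, where $\mathfrak{m}$ is the ideal of $\mathcal{P}(Q,S)$ generated by the arrows.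
   Context: Vector spaces and tensor products are over $\mathbb{C}$. $Q=(Q_0,Q_1,h,t)$ is a finite quiver without loops; an arrow $a$ goes from its tail $t(a)$ to its head $h(a)$. $R=\bigoplus_{i\in Q_0}\mathbb{C}e_i$ with $e_ie_j=\delta_{ij}e_i$; $A$ is the $R$-bimodule with basis $Q_1$, $e_iAe_j$ spanned by arrows $j\to i$; $R\langle A\rangle$ is the path algebra (paths written right to left). The potential $S\in R\langle A\rangle$ is a finite linear combination of cyclic paths of positive length (up to cyclic rotation); $\partial_a(a_1\cdots a_d)=\sum_{p:a_p=a}a_{p+1}\cdots a_da_1\cdots a_{p-1}$. Under the assumption in the claim the Jacobian algebra $\mathcal{P}(Q,S)$ (the quotient of the complete path algebra by the closure of the ideal generated by all $\partial_aS$) is identified with the finite-dimensional algebra $R\langle A\rangle/J_0$. For arrows $a,b$ with $h(a)=t(b)$, $\partial_{ba}S$ is obtained by cyclically rotating the paths in $S$ so that none has first letter $a_1=a$, and setting $\partial_{ba}(a_1\cdots a_d)=\sum_{\nu:a_{\nu-1}=b,a_\nu=a}a_{\nu+1}\cdots a_da_1\cdots a_{\nu-2}$. A $\mathcal{P}(Q,S)$-module $M$ is given by spaces $M(i)=e_iM$ and maps $a_M:M(t(a))\to M(h(a))$. $M_{\rm in}(k)=\bigoplus_{h(a)=k}M(t(a))$, $M_{\rm out}(k)=\bigoplus_{t(b)=k}M(h(b))$; $\alpha_k:M_{\rm in}(k)\to M(k)$ has components $a_M$, and $\gamma_k:M_{\rm out}(k)\to M_{\rm in}(k)$ has components $(\partial_{ba}S)_M:M(h(b))\to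 M(t(a))$; one has $\alpha_k\gamma_k=0$. $P_k=\bigoplus_{i\in Q_0}e_i\mathcal{P}(Q,S)e_k$ is the indecomposable projective module at $k$. Define module homomorphisms $\varphi:\bigoplus_kP_k\otimes M_{\rm in}(k)\to\bigoplus_kP_k\otimes M(k)$ and ${\rm ev}:\bigoplus_kP_k\otimes M(k)\to M$ by $$\varphi(p\otimes m)=\sum_{h(a)=k}pa\otimes\mathrm{pr}_{t(a)}m-p\otimes\alpha_k(m)\quad(p\in P_k,\,m\in M_{\rm in}(k)),\qquad {\rm ev}(p\otimes m)=pm\quad(p\in P_k,\,m\in M(k)),$$ where $\mathrm{pr}_{t(a)}$ is the projection of $M_{\rm in}(k)$ to the summand $M(t(a))$ corresponding to $a$. For every $k\in Q_0$ choose subspaces $U'_k,U''_k\subseteq M_{\rm in}(k)$ and $M^{(0)}(k)\subseteq M(k)$ with $$\ker\alpha_k=\mathrm{im}\,\gamma_k\oplus U'_k,\quad M_{\rm in}(k)=\ker\alpha_k\oplus U''_k,\quad M(k)=M^{(0)}(k)\oplus\mathrm{im}\,\alpha_k,$$ and put $P'=\bigoplus_kP_k\otimes\ker\alpha_k$, $P''=\bigoplus_kP_k\otimes U''_k$, $P^{(1)}=\bigoplus_kP_k\otimes U'_k$, $P^{(0)}=\bigoplus_kP_k\otimes M^{(0)}(k)$, regarded as submodules of the source (for $P',P'',P^{(1)}$) and of the target (for $P^{(0)}$) of $\varphi$. *)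

(* Defs.v *)
From HB Require Import structures.
From mathcomp Require Import all_boot all_order all_algebra.
From mathcomp Require Import generic_quotient ring_quotient.
From mathcomp Require Import boolp classical_sets reals complex.
From mathcomp Require Import finmap monalg.

Set Implicit Arguments.
Unset Strict Implicit.
Unset Printing Implicit Defensive.

Import GRing.Theory.

Local Open Scope classical_set_scope.
Local Open Scope ring_scope.

(* Finite sums of elements of [G].  As every [G] used below is closed under   *)
(* scalars, this is also its linear span.                                     *)
Definition sums_of (V : zmodType) (G : set V) : set V :=
  [set x | exists2 s : seq V, (forall y, y \in s -> G y) & x = \sum_(y <- s) y].

Section SumsOf.
Context {V : zmodType}.
Implicit Types (G : set V) (x y : V).

Lemma sums_of0 G : sums_of G 0.
Proof. by exists [::] => //; rewrite big_nil. Qed.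

Lemma sums_of_sub G x : G x -> sums_of G x.
Proof.
by move=> Gx; exists [:: x]; [move=> y /[!inE] /eqP-> | rewrite big_seq1].
Qed.

Lemma sums_ofD G x y : sums_of G x -> sums_of G y -> sums_of G (x + y).
Proof.
move=> [s sG ->] [t tG ->]; exists (s ++ t); last by rewrite big_cat.
by move=> z; rewrite mem_cat => /orP[/sG|/tG].
Qed.

End SumsOf.

Lemma sums_of_map (V W : zmodType) (f : V -> W) (G : set V) (H : set W) :
  f 0 = 0 -> {morph f : x y / x + y} -> (forall x, G x -> H (f x)) ->
  forall x, sums_of G x -> sums_of H (f x).
Proof.
move=> f0 fD fGH _ [s sG ->]; exists (map f s); last first.
  by rewrite big_map; elim/big_ind2: _ => // ? ? ? ? <- <-.
by move=> _ /mapP[y ys ->]; exact/fGH/sG.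
Qed.

Section Ideals.
Variable A : pzRingType.

(* The two-sided ideal generated by [G]. *)
Definition ideal_gen (G : set A) : set A :=
  sums_of [set x | exists u, exists2 g, G g & exists v, x = u * g * v].

Fixpoint ideal_pow (I : set A) (n : nat) : set A :=
  if n is n'.+1 then
    sums_of [set z | exists2 x, I x & exists2 y, ideal_pow I n' y & z = x * y]
  else setT.

(* The submodule [I N] of a left module. *)
Definition ideal_act (V : lmodType A) (I : set A) (N : set V) : set V :=
  sums_of [set y | exists2 c, I c & exists2 x, N x & y = c *: x].

End Ideals.

Section IdealGen.
Variables (A : pzRingType) (G : set A).

Lemma ideal_gen_sub x : G x -> ideal_gen G x.
Proof.
move=> Gx; apply: sums_of_sub; exists 1, x => //.
by exists 1; rewrite mul1r mulr1.
Qed.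

Lemma ideal_genMl u x : ideal_gen G x -> ideal_gen G (u * x).
Proof.
apply: sums_of_map; [exact: mulr0 | exact: mulrDr |].
by move=> _ [u' [g Gg [v ->]]]; exists (u * u'), g => //; exists v; rewrite !mulrA.
Qed.

Lemma ideal_genMr u x : ideal_gen G x -> ideal_gen G (x * u).
Proof.
apply: (sums_of_map (f := fun x => x * u)).
- exact: mul0r.
- by move=> y z; rewrite mulrDl.
- by move=> _ [u' [g Gg [v ->]]]; exists u', g => //; exists (v * u); rewrite !mulrA.
Qed.

Lemma ideal_genN x : ideal_gen G x -> ideal_gen G (- x).
Proof. by rewrite -mulN1r; exact: ideal_genMl. Qed.

Definition ideal_pred : {pred A} := [pred x | `[< ideal_gen G x >]].

Lemma ideal_predP x : reflect (ideal_gen G x) (x \in ideal_pred).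
Proof. exact: asboolP. Qed.

Fact ideal_pred_zmod_closed : zmod_closed ideal_pred.
Proof.
split=> [|x y /ideal_predP Jx /ideal_predP Jy]; apply/ideal_predP.
  exact: sums_of0.
by apply: sums_ofD => //; exact: ideal_genN.
Qed.

HB.instance Definition _ :=
  GRing.isZmodClosed.Build A ideal_pred ideal_pred_zmod_closed.

End IdealGen.

(* The quotient of [A] by the two-sided ideal generated by [G]. *)
Definition quot_alg (A : pzRingType) (G : set A) := {ideal_quot (ideal_pred G)}.

Section QuotRing.
Variables (A : pzRingType) (G : set A).
Local Notation Q := (quot_alg G).

HB.instance Definition _ := GRing.Zmodule.on Q.

Definition quot_proj (x : A) : Q := (\pi_({ideal_quot (ideal_pred G)}) x)%qT.

Lemma quot_projK (z : Q) : exists x, z = quot_proj x.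
Proof. by exists (repr z); rewrite /quot_proj reprK. Qed.

Lemma quot_proj_eq x y : (quot_proj x = quot_proj y) <-> ideal_gen G (x - y).
Proof.
split=> [/eqP|Jxy]; last apply/eqP; rewrite /quot_proj -Quotient.idealrBE.
  by move/ideal_predP.
exact/ideal_predP.
Qed.

Lemma quot_proj_is_zmod_morphism : zmod_morphism quot_proj.
Proof. by move=> x y; rewrite /quot_proj !piE. Qed.
HB.instance Definition _ :=
  GRing.isZmodMorphism.Build A Q quot_proj quot_proj_is_zmod_morphism.

Definition quot_one : Q := quot_proj 1.
Definition quot_mul_def (x y : Q) : Q := quot_proj (repr x * repr y).
Fact quot_mul_key : unit. Proof. exact: tt. Qed.
Definition quot_mul := locked_with quot_mul_key quot_mul_def.
Canonical quot_mul_unlockable := [unlockable fun quot_mul].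

Lemma repr_quot_proj x : ideal_gen G (repr (quot_proj x) - x).
Proof. by apply/quot_proj_eq; rewrite /quot_proj reprK. Qed.

Lemma quot_mulE x y : quot_mul (quot_proj x) (quot_proj y) = quot_proj (x * y).
Proof.
rewrite unlock; apply/quot_proj_eq; set x' := repr _; set y' := repr _.
have -> : x' * y' - x * y = (x' - x) * y' + x * (y' - y).
  by rewrite mulrBl mulrBr addrA subrK.
apply: sums_ofD; [apply: ideal_genMr | apply: ideal_genMl]; exact: repr_quot_proj.
Qed.

Fact quot_mulA : associative quot_mul.
Proof.
move=> x y z; have [x' ->] := quot_projK x; have [y' ->] := quot_projK y.
by have [z' ->] := quot_projK z; rewrite !quot_mulE mulrA.
Qed.
Fact quot_mul1l : left_id quot_one quot_mul.
Proof. by move=> x; have [x' ->] := quot_projK x; rewrite quot_mulE mul1r. Qed.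
Fact quot_mul1r : right_id quot_one quot_mul.
Proof. by move=> x; have [x' ->] := quot_projK x; rewrite quot_mulE mulr1. Qed.
Fact quot_mulDl : left_distributive quot_mul +%R.
Proof.
move=> x y z; have [x' ->] := quot_projK x; have [y' ->] := quot_projK y.
have [z' ->] := quot_projK z.
by rewrite -raddfD !quot_mulE mulrDl raddfD.
Qed.
Fact quot_mulDr : right_distributive quot_mul +%R.
Proof.
move=> x y z; have [x' ->] := quot_projK x; have [y' ->] := quot_projK y.
have [z' ->] := quot_projK z.
by rewrite -raddfD !quot_mulE mulrDr raddfD.
Qed.

HB.instance Definition _ := GRing.Zmodule_isPzRing.Build Q
  quot_mulA quot_mul1l quot_mul1r quot_mulDl quot_mulDr.

Lemma quot_projM x y : quot_proj (x * y) = quot_proj x * quot_proj y.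
Proof. by rewrite -quot_mulE. Qed.

Lemma quot_proj1 : quot_proj 1 = 1.
Proof. by []. Qed.

End QuotRing.

Record quiver := Quiver {
  vertex : finType;
  arrow : finType;
  head : arrow -> vertex;
  tail : arrow -> vertex
}.
Arguments head {q} _.
Arguments tail {q} _.

Definition no_loops (Q : quiver) := forall a : arrow Q, head a <> tail a.

Definition no_2cycles (Q : quiver) :=
  forall a b : arrow Q, ~ (head a = tail b /\ head b = tail a).

(* Paths are written right to left: a path from [j] to [i] is a target [i]    *)
(* together with a word [a_1; ..; a_d] such that [head a_1 = i],              *)
(* [tail a_p = head a_{p+1}] and [tail a_d = j]; the empty word at [i] is the *)
(* trivial path [e_i].                                                        *)
Definition is_qpath (Q : quiver) (p : vertex Q * seq (arrow Q)) :=
  map head p.2 == belast p.1 (map tail p.2).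

Definition qpath (Q : quiver) := {p : vertex Q * seq (arrow Q) | is_qpath p}.

Section Paths.
Variable Q : quiver.
Implicit Types p q : qpath Q.

HB.instance Definition _ := Choice.on (qpath Q).

Definition target p : vertex Q := (val p).1.
Definition word p : seq (arrow Q) := (val p).2.
Definition source p : vertex Q := last (target p) (map tail (word p)).

Lemma qpath_ext p q : target p = target q -> word p = word q -> p = q.
Proof.
move=> tpq wpq; apply: val_inj; move: tpq wpq; rewrite /target /word.
by case: (val p) (val q) => [? ?] [? ?] /= -> ->.
Qed.

End Paths.

Lemma mkmalgUZ (F : fieldType) (K : choiceType) (c : F) (k : K) :
  mkmalgU k c = c *: mkmalgU k 1.
Proof. by apply/malgP => l; rewrite mcoeffZ !mcoeffU mulrnAr mulr1. Qed.

Section LinearExtension.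
Variables (F : pzRingType) (V : lmodType F) (T : Type) (b : T -> V).
Variable m : V -> V -> V.
Hypothesis b_ind : forall P : V -> Prop, (forall p, P (b p)) -> P 0 ->
  (forall c x y, P x -> P y -> P (c *: x + y)) -> forall x, P x.
Hypothesis ml : forall y, linear (m^~ y).
Hypothesis mr : forall x, linear (m x).

Lemma linext_mul0l y : m 0 y = 0.
Proof. by have := ml y (-1) 0 0; rewrite !scaleN1r !addNr. Qed.

Lemma linext_mul0r x : m x 0 = 0.
Proof. by have := mr x (-1) 0 0; rewrite !scaleN1r !addNr. Qed.

Lemma linext_mulZl c x y : m (c *: x) y = c *: m x y.
Proof. by have := ml y c x 0; rewrite linext_mul0l !addr0. Qed.

Lemma linext_mulZr c x y : m x (c *: y) = c *: m x y.
Proof. by have := mr x c y 0; rewrite linext_mul0r !addr0. Qed.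

Lemma linext_mulDl : left_distributive m +%R.
Proof. by move=> x y z; have := ml z 1 x y; rewrite !scale1r. Qed.

Lemma linext_mulDr : right_distributive m +%R.
Proof. by move=> x y z; have := mr x 1 y z; rewrite !scale1r. Qed.

Lemma linext_mulA :
  (forall p q r, m (b p) (m (b q) (b r)) = m (m (b p) (b q)) (b r)) ->
  associative m.
Proof.
have zl := linext_mul0l; have zr := linext_mul0r.
move=> bA x y z.
elim/b_ind: x => [p||c x x' IH IH']; last 2 first.
- by rewrite !zl.
- by rewrite !ml IH IH'.
elim/b_ind: y => [q||c y y' IH IH']; last 2 first.
- by rewrite !(zl, zr).
- by rewrite !(ml, mr) IH IH'.
elim/b_ind: z => [r||c z z' IH IH']; last 2 first.
- by rewrite !zr.
- by rewrite !mr IH IH'.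
exact: bA.
Qed.

Lemma linext_mul1l e : (forall p, m e (b p) = b p) -> left_id e m.
Proof.
move=> be x; elim/b_ind: x => [//||c x y IH IH']; first exact: linext_mul0r.
by rewrite mr IH IH'.
Qed.

Lemma linext_mul1r e : (forall p, m (b p) e = b p) -> right_id e m.
Proof.
move=> be x; elim/b_ind: x => [//||c x y IH IH']; first exact: linext_mul0l.
by rewrite ml IH IH'.
Qed.

End LinearExtension.

Definition path_algebra (F : fieldType) (Q : quiver) := {malg F[qpath Q]}.

Section PathAlgebra.
Variables (F : fieldType) (Q : quiver).
Local Notation PA := (path_algebra F Q).
Implicit Types (p q : qpath Q) (x y z : PA).

HB.instance Definition _ := GRing.Lmodule.on PA.

(* Some operations are locked so that unification does not unfold them. *)
Definition pbasis_def p : PA := mkmalgU p 1.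
Fact pbasis_key : unit. Proof. exact: tt. Qed.
Definition pbasis := locked_with pbasis_key pbasis_def.
Canonical pbasis_unlockable := [unlockable fun pbasis].

(* The path with the given target and word, and [0] if this is not a path. *)
Definition pword (i : vertex Q) (w : seq (arrow Q)) : PA :=
  if insub (i, w) is Some p then pbasis p else 0.

Definition path_linear (V : lmodType F) (f : qpath Q -> V) x : V :=
  \sum_(p <- msupp x) x@_p *: f p.

Definition path_concat p q : PA :=
  if source p == target q then pword (target p) (word p ++ word q) else 0.

Definition path_mul_def x y : PA :=
  path_linear (fun p => path_linear (path_concat p) y) x.
Fact path_mul_key : unit. Proof. exact: tt. Qed.
Definition path_mul := locked_with path_mul_key path_mul_def.
Canonical path_mul_unlockable := [unlockable fun path_mul].

Definition path_one : PA := \sum_(i : vertex Q) pword i [::].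

Lemma path_linearw (V : lmodType F) (f : qpath Q -> V) x (d : {fset qpath Q}) :
  fsubset (msupp x) d -> path_linear f x = \sum_(p <- d) x@_p *: f p.
Proof.
move=> le_d; rewrite /path_linear (big_fset_incl _ le_d) // => p _.
by move/mcoeff_outdom->; rewrite scale0r.
Qed.

Lemma path_linear_is_linear (V : lmodType F) (f : qpath Q -> V) :
  linear (path_linear f).
Proof.
move=> c x y; pose d := fsetU (msupp x) (fsetU (msupp y) (msupp (c *: x + y))).
have [dx dy dz] : [/\ fsubset (msupp x) d, fsubset (msupp y) d
    & fsubset (msupp (c *: x + y)) d].
  by split; apply/fsubsetP => p pin; rewrite !in_fsetU pin ?orbT.
rewrite !(path_linearw f dx, path_linearw f dy, path_linearw f dz).
rewrite scaler_sumr -big_split; apply: eq_bigr => p _ /=.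
by rewrite mcoeffD mcoeffZ scalerDl scalerA.
Qed.
HB.instance Definition _ (V : lmodType F) (f : qpath Q -> V) :=
  GRing.isLinear.Build F PA V _ (path_linear f) (path_linear_is_linear f).

Lemma path_linear_basis (V : lmodType F) (f : qpath Q -> V) p :
  path_linear f (pbasis p) = f p.
Proof.
by rewrite unlock /path_linear msuppU oner_eq0 big_seq_fset1 mcoeffUU scale1r.
Qed.

Lemma path_expand x : x = \sum_(p <- msupp x) x@_p *: pbasis p.
Proof.
rewrite {1}[x]monalgE; apply: eq_bigr => p _; rewrite unlock; exact: mkmalgUZ.
Qed.

Lemma path_ext (V : lmodType F) (f g : {linear PA -> V}) :
  (forall p, f (pbasis p) = g (pbasis p)) -> f =1 g.
Proof.
move=> fg x; rewrite [x]path_expand !linear_sum.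
by apply: eq_bigr => p _; rewrite !linearZ /= fg.
Qed.

Lemma path_linear_eq (V : lmodType F) (f g : qpath Q -> V) x :
  f =1 g -> path_linear f x = path_linear g x.
Proof. by move=> fg; apply: eq_bigr => p _; rewrite fg. Qed.

Lemma path_linear_fun (V : lmodType F) c (f g : qpath Q -> V) x :
  path_linear (fun p => c *: f p + g p) x =
  c *: path_linear f x + path_linear g x.
Proof.
rewrite /path_linear scaler_sumr -big_split; apply: eq_bigr => p _ /=.
by rewrite scalerDr !scalerA mulrC.
Qed.

Lemma path_mulDZr x c y z :
  path_mul x (c *: y + z) = c *: path_mul x y + path_mul x z.
Proof.
rewrite [path_mul]unlock; apply: etrans (path_linear_fun _ _ _ _).
by apply: path_linear_eq => p; exact: path_linear_is_linear.
Qed.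

Lemma path_mulDZl y c x z : path_mul (c *: x + z) y = c *: path_mul x y + path_mul z y.
Proof. by rewrite [path_mul]unlock; exact: path_linear_is_linear. Qed.

Lemma path_mul_basis p q : path_mul (pbasis p) (pbasis q) = path_concat p q.
Proof. by rewrite [path_mul]unlock !path_linear_basis. Qed.

Lemma pwordE p : pword (target p) (word p) = pbasis p.
Proof.
rewrite /pword; case: insubP => [u _ |]; rewrite /target /word -surjective_pairing.
  by move/val_inj->.
by rewrite (valP p).
Qed.

Lemma is_qpath_cat (i : vertex Q) (v w : seq (arrow Q)) :
  is_qpath (i, v ++ w) =
  is_qpath (i, v) && is_qpath (last i (map tail v), w).
Proof.
rewrite /is_qpath /= !map_cat belast_cat eqseq_cat //.
by rewrite size_belast !size_map.
Qed.

Lemma pword_qpath (i : vertex Q) w : is_qpath (i, w) ->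
  exists p, [/\ pword i w = pbasis p, target p = i & word p = w].
Proof.
by move=> iw; exists (Sub (i, w) iw); split; rewrite -?pwordE /target /word ?SubK.
Qed.

Lemma path_concatP p q : source p = target q ->
  exists r, [/\ path_concat p q = pbasis r, target r = target p,
    source r = source q & word r = word p ++ word q].
Proof.
move=> pq; rewrite /path_concat pq eqxx.
have /pword_qpath [r [-> rt rw]] : is_qpath (target p, word p ++ word q).
  rewrite is_qpath_cat -/(source p) pq /target /word -!surjective_pairing.
  by rewrite !(valP _).
exists r; split=> //.
by rewrite /source rt rw map_cat last_cat -/(source p) pq.
Qed.

Lemma path_concatN p q : source p != target q -> path_concat p q = 0.
Proof. by rewrite /path_concat => /negPf->. Qed.

Lemma path_mul_linl y : linear (fun x => path_mul x y).
Proof. by move=> c x z; exact: path_mulDZl. Qed.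
Lemma path_mul_linr x : linear (path_mul x).
Proof. by move=> c y z; exact: path_mulDZr. Qed.

Lemma path_ind (P : PA -> Prop) : (forall p, P (pbasis p)) -> P 0 ->
  (forall c x y, P x -> P y -> P (c *: x + y)) -> forall x, P x.
Proof.
move=> Pb P0 PL x; rewrite [x]path_expand.
by elim/big_rec: _ => // p y _; apply: PL.
Qed.

Lemma path_mul0l y : path_mul 0 y = 0.
Proof. exact: (linext_mul0l path_mul_linl). Qed.
Lemma path_mul0r x : path_mul x 0 = 0.
Proof. exact: (linext_mul0r path_mul_linr). Qed.

Fact path_mulA : associative path_mul.
Proof.
apply: (linext_mulA path_ind path_mul_linl path_mul_linr) => p q r.
rewrite (path_mul_basis q r) (path_mul_basis p q).
have [pq|pq] := eqVneq (source p) (target q);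
  have [qr|qr] := eqVneq (source q) (target r).
- have [s [-> st ss sw]] := path_concatP pq.
  have [u [-> ut us uw]] := path_concatP qr.
  rewrite (path_mul_basis p u) (path_mul_basis s r) /path_concat.
  by rewrite ut pq ss qr !eqxx st sw uw catA.
- have [s [-> st ss sw]] := path_concatP pq.
  rewrite (path_concatN qr) (path_mul0r (pbasis p)) (path_mul_basis s r).
  by rewrite path_concatN ?ss.
- have [u [-> ut us uw]] := path_concatP qr.
  rewrite (path_concatN pq) (path_mul0l (pbasis r)) (path_mul_basis p u).
  by rewrite path_concatN ?ut.
- by rewrite (path_concatN pq) (path_concatN qr) path_mul0l path_mul0r.
Qed.

Lemma pword_nil i : exists p,
  [/\ pword i [::] = pbasis p, target p = i, source p = i & word p = [::]].
Proof.
have /pword_qpath [p [-> pt pw]] : is_qpath (i, [::]) by rewrite /is_qpath.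
by exists p; split=> //; rewrite /source pt pw.
Qed.

Fact path_mul1l : left_id path_one path_mul.
Proof.
apply: (linext_mul1l path_ind path_mul_linr) => p.
rewrite [path_mul]unlock /path_one linear_sum (bigD1 (target p)) //= big1 ?addr0.
  have [q [-> qt qs qw]] := pword_nil (target p).
  rewrite !path_linear_basis /path_concat qs eqxx qt qw /=; exact: pwordE.
move=> i ip; have [q [-> qt qs qw]] := pword_nil i.
by rewrite !path_linear_basis path_concatN ?qs.
Qed.

Fact path_mul1r : right_id path_one path_mul.
Proof.
apply: (linext_mul1r path_ind path_mul_linl) => p.
rewrite [path_mul]unlock path_linear_basis /path_one linear_sum (bigD1 (source p)) //=.
rewrite big1 ?addr0.
  have [q [-> qt qs qw]] := pword_nil (source p).
  by rewrite !path_linear_basis /path_concat qt eqxx qw cats0 pwordE.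
move=> i ip; have [q [-> qt qs qw]] := pword_nil i.
by rewrite !path_linear_basis path_concatN ?qt 1?eq_sym.
Qed.

Fact path_mulDl : left_distributive path_mul +%R.
Proof. exact: (linext_mulDl path_mul_linl). Qed.
Fact path_mulDr : right_distributive path_mul +%R.
Proof. exact: (linext_mulDr path_mul_linr). Qed.

HB.instance Definition _ := GRing.Zmodule_isPzRing.Build PA
  path_mulA path_mul1l path_mul1r path_mulDl path_mulDr.

Lemma path_scalerAl (c : F) (x y : PA) : c *: (x * y) = (c *: x) * y.
Proof. by apply/esym; exact: (linext_mulZl path_mul_linl). Qed.
Lemma path_scalerAr (c : F) (x y : PA) : c *: (x * y) = x * (c *: y).
Proof. by apply/esym; exact: (linext_mulZr path_mul_linr). Qed.

Definition pvertex (i : vertex Q) : PA := pword i [::].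
Definition parrow (a : arrow Q) : PA := pword (head a) [:: a].

Definition arrow_ideal : set PA := ideal_gen (range parrow).

Definition is_potential (S : PA) := forall p, p \in msupp S ->
  source p = target p /\ word p <> [::].

(* Index [n] below is the position [p - 1] of the letter [a_p]; the quotient  *)
(* path runs from [head a] to [tail a].                                       *)
Definition cyc_deriv_word (a : arrow Q) (w : seq (arrow Q)) : PA :=
  \sum_(n < size w | nth a w n == a) pword (tail a) (drop n.+1 w ++ take n w).

Definition cyc_deriv (a : arrow Q) (S : PA) : PA :=
  path_linear (fun p => cyc_deriv_word a (word p)) S.

(* The cyclic word is first rotated so that it does not start with [a]; index *)
(* [n] is the position of the letter [b] and [n.+1] that of [a].              *)
Definition deriv2_word (b a : arrow Q) (w : seq (arrow Q)) : PA :=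
  let w' := rot (find (predC1 a) w) w in
  \sum_(n < (size w).-1 | (nth a w' n == b) && (nth b w' n.+1 == a))
    pword (tail a) (drop n.+2 w' ++ take n w').

Definition deriv2 (b a : arrow Q) (S : PA) : PA :=
  path_linear (fun p => deriv2_word b a (word p)) S.

Definition jacobian_ideal (S : PA) : set PA :=
  ideal_gen (range (cyc_deriv^~ S)).

Definition jacobian (S : PA) := quot_alg (range (cyc_deriv^~ S)).

End PathAlgebra.

Section Jacobian.
Variables (F : fieldType) (Q : quiver) (S : path_algebra F Q).
Local Notation P := (jacobian S).

HB.instance Definition _ := GRing.PzRing.on P.

Definition jac_proj (x : path_algebra F Q) : P := quot_proj _ x.
HB.instance Definition _ := GRing.isZmodMorphism.Build
  (path_algebra F Q) P jac_proj (quot_proj_is_zmod_morphism _).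

Lemma jac_projK (z : P) : exists x, z = jac_proj x.
Proof. exact: quot_projK. Qed.
Lemma jac_proj_eq x y : jac_proj x = jac_proj y <-> jacobian_ideal S (x - y).
Proof. exact: quot_proj_eq. Qed.
Lemma jac_projM x y : jac_proj (x * y) = jac_proj x * jac_proj y.
Proof. exact: quot_projM. Qed.


Definition jac_scale_def (c : F) (x : P) : P := jac_proj (c *: repr x).
Fact jac_scale_key : unit. Proof. exact: tt. Qed.
Definition jac_scale := locked_with jac_scale_key jac_scale_def.
Canonical jac_scale_unlockable := [unlockable fun jac_scale].

Lemma jac_scaleE c x : jac_scale c (jac_proj x) = jac_proj (c *: x).
Proof.
rewrite unlock; apply/jac_proj_eq; rewrite -scalerBr -[_ - x]mul1r path_scalerAl.
exact/ideal_genMl/repr_quot_proj.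
Qed.

Fact jac_scaleA (a b : F) (x : P) :
  jac_scale a (jac_scale b x) = jac_scale (a * b) x.
Proof. by have [y ->] := jac_projK x; rewrite !jac_scaleE scalerA. Qed.
Fact jac_scale1 : left_id 1 jac_scale.
Proof. by move=> x; have [y ->] := jac_projK x; rewrite jac_scaleE scale1r. Qed.
Fact jac_scaleDr : right_distributive jac_scale +%R.
Proof.
move=> a x y; have [x' ->] := jac_projK x; have [y' ->] := jac_projK y.
by rewrite -raddfD !jac_scaleE scalerDr raddfD.
Qed.
Fact jac_scaleDl (x : P) : {morph jac_scale^~ x : a b / a + b}.
Proof.
move=> a b; have [x' ->] := jac_projK x.
by rewrite !jac_scaleE scalerDl raddfD.
Qed.

HB.instance Definition _ := GRing.Zmodule_isLmodule.Build F P
  jac_scaleA jac_scale1 jac_scaleDr jac_scaleDl.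

Lemma jac_projZ (c : F) x : jac_proj (c *: x) = c *: jac_proj x.
Proof. by rewrite -jac_scaleE. Qed.

Lemma jac_scalerAl (c : F) (x y : P) : c *: (x * y) = (c *: x) * y.
Proof.
have [x' ->] := jac_projK x; have [y' ->] := jac_projK y.
by rewrite -jac_projZ -!jac_projM -jac_projZ path_scalerAl.
Qed.
Lemma jac_scalerAr (c : F) (x y : P) : c *: (x * y) = x * (c *: y).
Proof.
have [x' ->] := jac_projK x; have [y' ->] := jac_projK y.
by rewrite -jac_projZ -!jac_projM -jac_projZ path_scalerAr.
Qed.

Definition jvertex (i : vertex Q) : P := jac_proj (pvertex F i).
Definition jarrow (a : arrow Q) : P := jac_proj (parrow F a).

(* The ideal [m] of the Jacobian algebra. *)
Definition jarrow_ideal : set P := ideal_gen (range jarrow).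

(* [P_k], as the left ideal [P e_k]; it is the direct sum of the [e_i P e_k]  *)
(* since the [e_i] sum to 1.                                                  *)
Definition jproj (k : vertex Q) : set P := [set p | exists q, p = q * jvertex k].

(* Left modules over the Jacobian algebra on a finite-dimensional space.      *)
Record jac_module (M : vectType F) := JacModule {
  jact :> {linear P -> 'End(M)};
  jact1 : jact 1 = \1%VF;
  jactM : forall x y : P, jact (x * y) = (jact x \o jact y)%VF
}.

End Jacobian.
Arguments jvertex {F Q S}.
Arguments jarrow {F Q S}.
Arguments jproj {F Q} S.
Arguments jarrow_ideal {F Q} S.

Section Tensor.
Variables (F : fieldType) (Q : quiver) (S : path_algebra F Q) (W : vectType F).
Local Notation P := (jacobian S).

(* A model of the tensor product over [F] of the Jacobian algebra with the    *)
(* finite-dimensional space [W], by coordinates with respect to the basis     *)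
(* [vbasis fullv] of [W]; it is a left module through the first factor.       *)
(* Lemmas [tensDl], [tensDr], [tensZ], [tens_gen] and [tens_liftE] give its   *)
(* universal property.                                                        *)
Definition tensor := 'rV[P]_(\dim {:W}).

HB.instance Definition _ := GRing.Lmodule.on tensor.

Definition tens (p : P) (w : W) : tensor :=
  \row_i (coord (vbasis {:W}) i w *: p).

Definition tens_lift (Z : zmodType) (f : P -> W -> Z) (x : tensor) : Z :=
  \sum_i f (x 0 i) (vbasis {:W})`_i.

Lemma tensDl p q w : tens (p + q) w = tens p w + tens q w.
Proof. by apply/rowP => i; rewrite !mxE scalerDr. Qed.

Lemma tensDr p v w : tens p (v + w) = tens p v + tens p w.
Proof. by apply/rowP => i; rewrite !mxE linearD scalerDl. Qed.

Lemma tensZ (c : F) p w : tens (c *: p) w = tens p (c *: w).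
Proof.
by apply/rowP => i; rewrite !mxE scalerA; congr (_ *: p); rewrite linearZ mulrC.
Qed.

Lemma tensMl p q w : tens (p * q) w = p *: tens q w.
Proof. by apply/rowP => i; rewrite !mxE jac_scalerAr. Qed.

Lemma tens_gen x : sums_of [set y | exists p w, y = tens p w] x.
Proof.
exists [seq tens (x 0 i) (vbasis {:W})`_i | i <- enum 'I_(\dim {:W})].
  by move=> y /mapP[i _ ->]; exists (x 0 i), (vbasis {:W})`_i.
rewrite big_map big_enum /=; apply/rowP => j; rewrite summxE (bigD1 j) //=.
have fb : free (vbasis {:W}) by exact: basis_free (vbasisP _).
rewrite big1 => [|i ij]; rewrite !mxE coord_free //.
  by rewrite eqxx scale1r addr0.
by rewrite (negPf ij) scale0r.
Qed.

Lemma tens_liftE (Z : zmodType) (f : P -> W -> Z) :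
  (forall p, {morph f p : v w / v + w}) ->
  (forall (c : F) p w, f (c *: p) w = f p (c *: w)) ->
  forall p w, tens_lift f (tens p w) = f p w.
Proof.
move=> fD fZ p w; rewrite [in RHS](coord_vbasis (memvf w)).
have f0 : f p 0 = 0 by apply: (addIr (f p 0)); rewrite -fD !add0r.
rewrite (big_morph (f p) (fD p) f0); apply: eq_bigr => i _.
by rewrite mxE fZ.
Qed.

Lemma tens_lift_is_linear (Z : zmodType) (f : P -> W -> Z) (g : P -> Z -> Z) :
  (forall c, {morph g c : x y / x + y}) ->
  (forall c p q w, f (c * p + q) w = g c (f p w) + f q w) ->
  forall c x y, tens_lift f (c *: x + y) = g c (tens_lift f x) + tens_lift f y.
Proof.
move=> gD fg c x y; rewrite /tens_lift.
have g0 : g c 0 = 0 by apply: (addIr (g c 0)); rewrite -gD !add0r.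
rewrite (big_morph (g c) (gD c) g0) -big_split; apply: eq_bigr => i _.
by rewrite !mxE fg.
Qed.

(* The external direct sum over [k] of the modules [P_k (x) V_k], where       *)
(* [V_k] is a subspace of [W]; it consists of the families whose [k]-th       *)
(* component is a sum of pure tensors [p (x) w] with [p] in [P_k] and [w] in  *)
(* [V_k].                                                                     *)
Definition proj_tens (V : vertex Q -> {vspace W}) :
    set {ffun vertex Q -> tensor} :=
  [set x | forall k, sums_of
    [set y | exists2 p, jproj S k p & exists2 w, w \in V k & y = tens p w] (x k)].

End Tensor.
Arguments tensor {F Q} S W.
Arguments tens {F Q S W}.
Arguments proj_tens {F Q} S {W}.

Definition dsum_inj (I : finType) (Z : zmodType) (i : I) (z : Z) :
    {ffun I -> Z} :=
  [ffun j => if j == i then z else 0].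

Lemma dsum_inj_is_linear (F : pzRingType) (V : lmodType F) (I : finType) (i : I) :
  linear (@dsum_inj I V i).
Proof.
move=> c x y; apply/ffunP => j; rewrite !ffunE.
by case: eqP => // _; rewrite scaler0 addr0.
Qed.
HB.instance Definition _ (F : pzRingType) (V : lmodType F) (I : finType) (i : I) :=
  GRing.isLinear.Build F V {ffun I -> V} _ (@dsum_inj I V i)
    (@dsum_inj_is_linear F V I i).

Section Presentation.
Variables (F : fieldType) (Q : quiver) (S : path_algebra F Q).
Variables (M : vectType F) (act : jac_module S M).
Local Notation P := (jacobian S).

Definition mspace (k : vertex Q) : {vspace M} := limg (act (jvertex k)).

(* The direct sums [M_in(k)] and [M_out(k)] are realised inside the space of  *)
(* all families of elements of [M] indexed by the arrows.                     *)
Local Notation AM := {ffun arrow Q -> M}.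

Definition arr_inj (a : arrow Q) : 'Hom(M, AM) := linfun (dsum_inj a).
Definition arr_proj (a : arrow Q) : 'Hom(AM, M) := linfun (fun m : AM => m a).

Definition m_in (k : vertex Q) : {vspace AM} :=
  (\sum_(a | head a == k) arr_inj a @: mspace (tail a))%VS.
Definition m_out (k : vertex Q) : {vspace AM} :=
  (\sum_(b | tail b == k) arr_inj b @: mspace (head b))%VS.

Definition alpha (k : vertex Q) : 'Hom(AM, M) :=
  \sum_(a | head a == k) (act (jarrow a) \o arr_proj a)%VF.

Definition gamma (k : vertex Q) : 'Hom(AM, AM) :=
  \sum_(a | head a == k) \sum_(b | tail b == k)
    (arr_inj a \o act (jac_proj S (deriv2 b a S)) \o arr_proj b)%VF.

Definition ker_alpha k : {vspace AM} := (m_in k :&: lker (alpha k))%VS.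
Definition im_alpha k : {vspace M} := (alpha k @: m_in k)%VS.
Definition im_gamma k : {vspace AM} := (gamma k @: m_out k)%VS.

Definition phi (x : {ffun vertex Q -> tensor S AM}) :
    {ffun vertex Q -> tensor S M} :=
  \sum_k tens_lift (fun p (m : AM) =>
    \sum_(a | head a == k) dsum_inj (tail a) (tens (p * jarrow a) (m a))
    - dsum_inj k (tens p (alpha k m))) (x k).

Definition ev (y : {ffun vertex Q -> tensor S M}) : M :=
  \sum_k tens_lift (fun p m => act p m) (y k).

Lemma arr_injE a m : arr_inj a m = dsum_inj a m.
Proof. by rewrite lfunE. Qed.

Lemma arr_projE a (m : AM) : arr_proj a m = m a.
Proof.
have lin : linear (fun m : AM => m a) by move=> c x y; rewrite !ffunE.
pose g : {linear AM -> M} := HB.pack (fun m : AM => m a)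
  (GRing.isLinear.Build F AM M _ _ lin).
exact: (lfunE g).
Qed.

Lemma alphaE k (m : AM) :
  alpha k m = \sum_(a | head a == k) act (jarrow a) (m a).
Proof.
by rewrite sum_lfunE; apply: eq_bigr => a _; rewrite comp_lfunE arr_projE.
Qed.

Lemma gammaE k (m : AM) :
  gamma k m = \sum_(a | head a == k) \sum_(b | tail b == k)
    dsum_inj a (act (jac_proj S (deriv2 b a S)) (m b)).
Proof.
rewrite sum_lfunE; apply: eq_bigr => a _; rewrite sum_lfunE.
by apply: eq_bigr => b _; rewrite !comp_lfunE arr_projE arr_injE.
Qed.

Lemma phi_is_linear : linear phi.
Proof.
move=> c x y; rewrite /phi scaler_sumr -big_split; apply: eq_bigr => k _ /=.
rewrite !ffunE; apply: (tens_lift_is_linear (g := fun c z => c *: z)).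
  by move=> d; exact: scalerDr.
move=> d p q m; rewrite scalerBr scaler_sumr addrACA -big_split -opprD /=.
congr (_ - _).
  apply: eq_bigr => a _.
  by rewrite mulrDl -mulrA tensDl tensMl linearP.
by rewrite tensDl tensMl linearP.
Qed.
HB.instance Definition _ := GRing.isLinear.Build P _ _ _ phi phi_is_linear.

Lemma phi_tens k p (m : AM) :
  phi (dsum_inj k (tens p m)) =
  \sum_(a | head a == k) dsum_inj (tail a) (tens (p * jarrow a) (m a))
  - dsum_inj k (tens p (alpha k m)).
Proof.
rewrite /phi (bigD1 k) //= big1 ?addr0 => [|j jk]; rewrite ffunE.
  rewrite eqxx tens_liftE //= => {m} [q m m' | c q m].
    rewrite addrACA -big_split -opprD linearD tensDr linearD; congr (_ - _).
    by apply: eq_bigr => a _; rewrite ffunE tensDr linearD.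
  rewrite tensZ linearZ; congr (_ - _); apply: eq_bigr => a _.
  by rewrite ffunE -jac_scalerAl tensZ.
rewrite (negPf jk) /tens_lift big1 // => i _; rewrite mxE.
have t0 (W : vectType F) (w : W) : tens (0 : P) w = 0.
  by apply: (addIr (tens 0 w)); rewrite -tensDl !add0r.
by rewrite t0 linear0 subr0 big1 // => a _; rewrite mul0r t0 linear0.
Qed.

Lemma ev_is_linear (c : P) x y : ev (c *: x + y) = act c (ev x) + ev y.
Proof.
rewrite /ev linear_sum -big_split; apply: eq_bigr => k _ /=.
rewrite !ffunE; apply: (tens_lift_is_linear (g := fun c z => act c z)).
  by move=> d; exact: linearD.
by move=> d p q m; rewrite linearD add_lfunE jactM comp_lfunE.
Qed.

Lemma ev_tens k p m : ev (dsum_inj k (tens p m)) = act p m.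
Proof.
rewrite /ev (bigD1 k) //= big1 ?addr0 => [|j jk]; rewrite ffunE.
  rewrite eqxx tens_liftE // => {m} [q m m' | c q m]; first exact: linearD.
  by rewrite !linearZ scale_lfunE.
by rewrite (negPf jk) /tens_lift big1 // => i _; rewrite mxE linear0 lfunE.
Qed.

Section Phibar.
Variables (U2 : vertex Q -> {vspace AM}) (M0 : vertex Q -> {vspace M}).

(* The element [p''] attached to [p']; [0] if there is none. *)
Definition correction (x : {ffun vertex Q -> tensor S AM}) :=
  xget 0 [set x2 | proj_tens S U2 x2 /\ proj_tens S M0 (phi (x - x2))].

Definition phibar x := phi (x - correction x).

End Phibar.

End Presentation.

(* [f] induces a bijection between the quotients [A / A'] and [B / B'] of     *)
(* submodules [A' <= A] and [B' <= B]; as [f] is a homomorphism on [A], this  *)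
(* bijection is an isomorphism of modules.                                    *)
Definition induces_iso (X Y : zmodType) (f : X -> Y) (A A' : set X)
    (B B' : set Y) :=
  [/\ f @` A `<=` B, f @` A' `<=` B',
      forall x, A x -> B' (f x) -> A' x
    & forall y, B y -> exists2 x, A x & B' (y - f x)].

(* Main.v *)
(* Write [L] for the Jacobian algebra, [m] for its (nilpotent) radical and       *)
(* [P_in], [P_out] for the source and the target of [phi].                       *)
(* - [phi] is [- (1 (x) alpha)] up to a map raising the radical degree; as       *)
(*   [alpha] maps [U''] isomorphically onto [im alpha], nilpotency of [m] gives  *)
(*   the existence and uniqueness of the correction [p''].                       *)
(* - Moving arrows across the tensor sign gives [im phi = ker ev], whence        *)
(*   [phibar P' = P0 /\ ker ev].  For [n] in [M (head b)], the equality          *)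
(*   [cyc_deriv b S (x) n = 0] and [cyc_deriv b S = \sum_a a * deriv2 b a S]     *)
(*   put [phi (e_k (x) gamma n)] in [phi (m P_in)], and Nakayama's lemma         *)
(*   replaces [P'] by [P1].                                                      *)
(* - For minimality, the Fox derivative [fox a] (strip an initial letter [a])    *)
(*   sends [h (x) n] to the family [(fox a h) n]; modulo [im gamma] this is well *)
(*   defined on [P_out], since [fox a (cyc_deriv b S) = deriv2 b a S], and       *)
(*   composed with [phi] it is the reduction modulo [m].  Hence [ker phi] lies   *)
(*   in [m P_in + P (x) im gamma], so that [phibar x = 0] with [x] in [P1]       *)
(*   forces [x] to be in [m P1].                                                 *)

From HB Require Import structures.
Require Import Defs.
From mathcomp Require Import all_boot all_order all_algebra.
From mathcomp Require Import boolp classical_sets reals complex.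
From mathcomp Require Import finmap monalg.

Import GRing.Theory.

Local Open Scope classical_set_scope.
Local Open Scope ring_scope.

Set Implicit Arguments.
Unset Strict Implicit.
Unset Printing Implicit Defensive.
Local Notation head := Defs.head.

(** * Fox calculus in the path algebra *)

(** Direct sums of [P_k (x) V_k] are filtered by powers of the arrow ideal m, which is nilpotent by
    [rad_nilpotent]. Since [phi + 1 (x) alpha] raises the degree ([phi_alpha_rad]) and [alpha] is
    injective on U'' with image [im_alpha], the equation for p'' is solved by successive
    approximation that stops: [correction_exists], [correction_unique].

    Exactness: modulo the image of [phi], arrows slide one by one across the tensor sign
    ([phi_word]), so [phi] has image the kernel of [ev] ([ev_phi], [phi_ker_ev]). Passing from P' to
    P1 loses nothing: the relation that the cyclic derivative at b is zero, written as the sum of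
    the [a * deriv2 b a S] ([cyc_deriv_expand]), shows that a generator from im gamma has the same
    image under [phi] as an element one degree deeper ([phi_gamma]). Iterating [phibar_ker_step]
    gives [im_phibar].

    Minimality: an x in P1 with zero image must lie in m P1. Fox derivatives of elements of the
    Jacobian ideal send M into im gamma ([fox_act_ideal]). After composition with a projection that
    kills im gamma and U'' and fixes U' ([U'_retraction]), stripping the first letter is therefore
    well defined on the target of [phi], and composed with [phi] it gives the projected constant
    term ([fox_tens_phi]). So the constant term of x vanishes ([phi_ker_radical]). *)

Lemma sums_of_ind (V : zmodType) (G : set V) (K : V -> Prop) :
  K 0 -> (forall x y, K x -> K y -> K (x + y)) -> (forall x, G x -> K x) ->
  forall x, sums_of G x -> K x.
Proof.
move=> K0 KD KG _ [s sG ->]; rewrite big_seq.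
by elim/big_ind: _ => // x /sG; exact: KG.
Qed.

Section PathCalculus.
Variables (F : fieldType) (Q : quiver).
Local Notation PA := (path_algebra F Q).
Implicit Types (i j k : vertex Q) (a b c : arrow Q) (v w : seq (arrow Q)).

Local Notation pword i w := (pword F i w).

Lemma pword_ind (K : PA -> Prop) : (forall i w, K (pword i w)) -> K 0 ->
  (forall (c : F) x y, K x -> K y -> K (c *: x + y)) -> forall x, K x.
Proof. by move=> Kw K0 KL; apply: path_ind => // p; rewrite -pwordE. Qed.

Lemma pword0 i w : ~~ is_qpath (i, w) -> pword i w = 0.
Proof. by move=> iw; rewrite /Defs.pword insubN. Qed.

Lemma pwordM i j v w :
  pword i v * pword j w =
  if last i (map tail v) == j then pword i (v ++ w) else 0.
Proof.
have [iv|iv] := boolP (is_qpath (i, v)); last first.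
  rewrite pword0 // mul0r; case: eqP => // _; rewrite pword0 //.
  by rewrite is_qpath_cat (negPf iv).
have [jw|jw] := boolP (is_qpath (j, w)); last first.
  rewrite [pword j w]pword0 // mulr0; case: eqP => // lj; rewrite pword0 //.
  by rewrite is_qpath_cat lj (negPf jw) andbF.
have [p [-> pt pw]] := pword_qpath F iv; have [q [-> qt qw]] := pword_qpath F jw.
rewrite [_ * _]path_mul_basis /path_concat /source pt pw qt qw.
by case: eqP.
Qed.

Lemma pvertexM i j : pvertex F i * pvertex F j = if i == j then pvertex F i else 0.
Proof. by rewrite pwordM. Qed.

Lemma pvertex_pword i j w : pvertex F j * pword i w = if i == j then pword i w else 0.
Proof. by rewrite pwordM /= eq_sym; case: eqP => [->|]. Qed.

Lemma parrow_tail a : parrow F a * pvertex F (tail a) = parrow F a.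
Proof. by rewrite pwordM /= eqxx. Qed.

Lemma parrow_head a : pvertex F (head a) * parrow F a = parrow F a.
Proof. by rewrite pvertex_pword eqxx. Qed.

Lemma pword_rcons i w a : pword i (rcons w a) = pword i w * parrow F a.
Proof.
rewrite pwordM cats1; case: eqP => // lw; rewrite pword0 // -cats1 is_qpath_cat.
rewrite [X in _ && X]/is_qpath /= !eqseq_cons andbT negb_and; apply/orP; right.
by apply/eqP => e; case: lw.
Qed.

(** Words grow on the right, the side on which [phi] multiplies by arrows. *)
Lemma path_ind_right (K : PA -> Prop) : (forall i, K (pvertex F i)) -> K 0 ->
  (forall (c : F) x y, K x -> K y -> K (c *: x + y)) ->
  (forall x a, K x -> K (x * parrow F a)) -> forall x, K x.
Proof.
move=> Kv K0 KL KM; apply: pword_ind => // i.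
by elim/last_ind => [|w a IH]; [exact: Kv | rewrite pword_rcons; exact: KM].
Qed.

Definition counit k : PA -> F^o :=
  path_linear (fun p => ((target p == k) && (word p == [::]))%:R : F^o).
HB.instance Definition _ k := GRing.Linear.on (counit k).

Lemma counit_pword k i w :
  counit k (pword i w) = ((i == k) && (w == [::]))%:R.
Proof.
have [iw|iw] := boolP (is_qpath (i, w)); last first.
  by rewrite pword0 // linear0; case: w iw => [|b w] //; rewrite andbF.
have [p [-> pt pw]] := pword_qpath F iw.
by rewrite /counit path_linear_basis pt pw.
Qed.

Definition fox_word a w : PA :=
  if w is b :: w' then if b == a then pword (tail a) w' else 0 else 0.
Definition fox a : PA -> PA := path_linear (fun p => fox_word a (word p)).
HB.instance Definition _ a := GRing.Linear.on (fox a).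

Lemma fox_pword a i w : fox a (pword i w) = if head a == i then fox_word a w else 0.
Proof.
have [iw|iw] := boolP (is_qpath (i, w)); last first.
  rewrite pword0 // linear0; case: eqP => // hi.
  case: w iw => // b w; rewrite /fox_word; case: eqP => // -> iw.
  rewrite pword0 //; move: iw; rewrite /is_qpath /= eqseq_cons hi eqxx /=.
  by case: w.
have [p [-> pt pw]] := pword_qpath F iw.
rewrite /fox path_linear_basis pw; case: eqP => // hi.
case: w iw {pw} => // b w; rewrite /is_qpath /= eqseq_cons => /andP[/eqP bi _].
by case: eqP => // ba; case: hi; rewrite -ba.
Qed.


Lemma counitM k (x y : PA) : counit k (x * y) = counit k x * counit k y.
Proof.
elim/pword_ind: x => [i v||c x x' IH IH']; last 2 first.
- by rewrite mul0r linear0 mul0r.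
- by rewrite mulrDl -path_scalerAl !linearP /= IH IH' mulrDl scalerAl.
elim/pword_ind: y => [j w||c y y' IH IH']; last 2 first.
- by rewrite mulr0 linear0 mulr0.
- by rewrite mulrDr -path_scalerAr !linearP /= IH IH' mulrDr scalerAr.
rewrite pwordM !counit_pword; case: v => [|b v] /=; last first.
  by rewrite andbF mul0r; case: eqP => _; rewrite ?linear0 // counit_pword andbF.
rewrite andbT; case: (i =P j) => [->|ij].
  by rewrite counit_pword; case: eqP; rewrite ?mul1r ?mul0r.
rewrite linear0; case: (i =P k) => [<-|]; last by rewrite mul0r.
by case: eqP => [/esym|]; rewrite ?mulr0.
Qed.

(** The first letter of a product of paths is that of the left factor, unless this factor is
    trivial; a trivial factor composes with a path starting with [a] only if it sits at [head a]. *)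
Lemma foxM a (x y : PA) :
  fox a (x * y) = fox a x * y + counit (head a) x *: fox a y.
Proof.
elim/pword_ind: x => [i v||c x x' IH IH']; last 2 first.
- by rewrite mul0r !linear0 mul0r scale0r addr0.
- rewrite !mulrDl -path_scalerAl !linearP /= IH IH' mulrDl -path_scalerAl.
  by rewrite scalerDl scalerDr addrACA scalerA.
elim/pword_ind: y => [j w||c y y' IH IH']; last 2 first.
- by rewrite mulr0 !linear0 mulr0 ?scaler0 addr0.
- rewrite mulrDr -path_scalerAr !linearP /= IH IH' mulrDr -path_scalerAr.
  by rewrite !scalerDr addrACA !scalerA [c * _]mulrC.
rewrite pwordM counit_pword !fox_pword; case: v => [|b v] /=; last first.
  rewrite andbF scale0r addr0; case: (eqVneq b a) => [->|ba]; last first.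
    rewrite !if_same mul0r; case: eqP; rewrite ?linear0 // fox_pword /=.
    by rewrite (negPf ba) if_same.
  case: eqP => lj; last by case: eqP => _; rewrite linear0 ?mul0r // pwordM; case: eqP.
  rewrite fox_pword /= eqxx; case: eqP => _; last by rewrite mul0r.
  by rewrite pwordM; case: eqP.
rewrite if_same mul0r add0r andbT; case: (i =P j) => [->|ij].
  rewrite fox_pword [j == _]eq_sym.
  by case: eqP => _; rewrite ?scale1r ?scale0r.
rewrite linear0; case: (i =P head a) => [hi|]; last by rewrite scale0r.
by case: (head a =P j) => [hj|]; rewrite ?scaler0 //; case: ij; rewrite hi.
Qed.

Lemma fox_arrow a b : fox a (parrow F b) = if b == a then pvertex F (tail a) else 0.
Proof. by rewrite fox_pword /=; case: (b =P a) => [->|]; rewrite ?eqxx ?if_same. Qed.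

Lemma fox_vertex a i : fox a (pvertex F i) = 0.
Proof. by rewrite fox_pword if_same. Qed.

Lemma counit_vertex k i : counit k (pvertex F i) = (i == k)%:R.
Proof. by rewrite counit_pword andbT. Qed.

(** A path is either trivial or a first letter followed by the rest. *)
Lemma fox_expand (x : PA) :
  x = \sum_k counit k x *: pvertex F k + \sum_a parrow F a * fox a x.
Proof.
elim/pword_ind: x => [i w||c x y IH IH']; last 2 first.
- by rewrite !big1 ?addr0 // => k _; rewrite linear0 ?mulr0 ?scale0r.
- rewrite [in LHS]IH [in LHS]IH' scalerDr addrACA; congr (_ + _).
    rewrite scaler_sumr -big_split; apply: eq_bigr => k _.
    by rewrite linearP scalerDl scalerA.
  rewrite scaler_sumr -big_split; apply: eq_bigr => k _.
  by rewrite linearP mulrDr path_scalerAr.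
case: w => [|b w].
  rewrite [X in _ + X]big1 => [|a _]; last by rewrite fox_vertex mulr0.
  rewrite addr0 (bigD1 i) //= big1 => [|k ki].
    by rewrite counit_vertex eqxx scale1r addr0.
  by rewrite counit_vertex eq_sym (negPf ki) scale0r.
rewrite big1 => [|k _]; last by rewrite counit_pword andbF scale0r.
rewrite add0r (bigD1 b) //= big1 => [|a ab]; last first.
  by rewrite fox_pword /= [b == a]eq_sym (negPf ab) if_same mulr0.
rewrite fox_pword /= eqxx addr0; case: (head b =P i) => [<-|hi].
  by rewrite pwordM /= eqxx.
rewrite mulr0 pword0 // /is_qpath /= eqseq_cons negb_and.
by apply/orP; left; apply/eqP.
Qed.

End PathCalculus.

(** * Cyclic derivatives *)

Section CyclicDerivatives.
Variables (F : fieldType) (Q : quiver).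
Local Notation PA := (path_algebra F Q).
Implicit Types (i j k : vertex Q) (a b c : arrow Q) (v w : seq (arrow Q)).

Lemma cyc_deriv_word_rot1 b w : cyc_deriv_word F b (rot 1 w) = cyc_deriv_word F b w.
Proof.
case: w => [|x w]; first by rewrite /rot.
rewrite rot1_cons /cyc_deriv_word size_rcons /= big_mkcond [RHS]big_mkcond /=.
(* The first letter of the word is the last one of its rotation, so its term is split off at
   opposite ends of the two sums. *)
rewrite big_ord_recr [RHS]big_ord_recl addrC /=; congr (_ + _).
  apply: eq_bigr => -[n nw] _ /=; rewrite /bump /= !add0n add1n nth_rcons nw.
  by case: eqP => // _; rewrite drop_rcons // cat_rcons -cats1 takel_cat 1?ltnW.
rewrite nth_rcons ltnn eqxx drop_oversize ?size_rcons // -cats1 take_size_cat //.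
by rewrite drop0 cats0.
Qed.

Lemma cyc_deriv_word_rot b n w : (n <= size w)%N ->
  cyc_deriv_word F b (rot n w) = cyc_deriv_word F b w.
Proof.
elim: n => [|n IH] nw; first by rewrite rot0.
by rewrite rotS // cyc_deriv_word_rot1 IH // ltnW.
Qed.

(** A cycle with all letters equal to [a] would make [a] a loop. This guarantees that the search in
    [deriv2_word] stops inside the word. *)
Lemma cyclic_word_no_loop a i w : no_loops Q ->
  is_qpath (i, w) -> last i (map tail w) = i -> w <> [::] -> has (predC1 a) w.
Proof.
move=> noloop iw li wN; apply: contraT; rewrite has_predC negbK => /allP wa.
case: (noloop a).
have -> : head a = i.
  case: w iw {li} wN wa => // b w; rewrite /is_qpath /= eqseq_cons => /andP[/eqP bi _].
  by move=> _ /(_ b); rewrite mem_head => /(_ isT) /eqP <-.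
rewrite -[LHS]li; case/lastP: w wN wa {iw li} => // w b _ /(_ b).
by rewrite mem_rcons mem_head map_rcons last_rcons => /(_ isT) /eqP ->.
Qed.

(** The cyclic derivative is invariant under rotation, so the word may be assumed not to start with
    [a]. Stripping [a] then keeps exactly the occurrences of [b] immediately followed by [a]. *)
Lemma fox_cyc_deriv_word a b i w : no_loops Q ->
  is_qpath (i, w) -> last i (map tail w) = i -> w <> [::] ->
  fox a (cyc_deriv_word F b w) = if head a == tail b then deriv2_word F b a w else 0.
Proof.
move=> noloop iw li wN; have wa := cyclic_word_no_loop a noloop iw li wN.
rewrite /deriv2_word; set m := find _ _; have mw : (m < size w)%N by rewrite -has_find.
rewrite -(cyc_deriv_word_rot b (ltnW mw)) -(size_rot m w).
have : nth a (rot m w) 0 != a.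
  by rewrite /rot nth_cat size_drop subn_gt0 mw nth_drop addn0; exact: (nth_find a wa).
have : rot m w <> [::] by apply/eqP; rewrite -size_eq0 size_rot size_eq0; apply/eqP.
move: (rot m w) => {m mw wa iw li wN} {}w wN w0.
rewrite /cyc_deriv_word linear_sum.
under eq_bigr => n _ do rewrite /= fox_pword.
case: eqP => hab; last by rewrite big1.
case sw: (size w) => [|s]; first by case: w sw wN {w0}.
rewrite big_mkcond [RHS]big_mkcond big_ord_recr /=.
have -> : drop s.+1 w = [::] by rewrite drop_oversize ?sw.
(* The wrap-around term, with [b] in last position: its word is empty or starts with the first
   letter of [w], which is not [a]. *)
have -> : fox_word F a ([::] ++ take s w) = 0.
  by case: w s sw w0 {wN} => // x w [|s] //= _ /negPf ->.
rewrite if_same addr0; apply: eq_bigr => -[n ns] _ /=.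
rewrite (set_nth_default a b) ?sw 1?ltnW // (set_nth_default a b (n:=n.+1)) ?sw //.
case: eqP => // _; rewrite (drop_nth a) ?sw //=.
Qed.

(** A constant term would come from a cyclic word of length one, that is, from a loop. *)
Lemma counit_cyc_deriv_word k b i w : no_loops Q ->
  is_qpath (i, w) -> last i (map tail w) = i -> counit k (cyc_deriv_word F b w) = 0.
Proof.
move=> noloop iw li; rewrite /cyc_deriv_word linear_sum big1 // => -[n nw] /= nb.
rewrite counit_pword; case: (_ =P [::]); rewrite ?andbF // => /eqP.
rewrite -size_eq0 size_cat size_drop size_takel 1?ltnW //.
case: w iw li nw nb => // x [|y w] //= iw lx; last first.
  by rewrite addn_eq0 subSS subn_eq0; case: n => [|n] ? ?; rewrite ?andbF.
by move: iw; rewrite /is_qpath /= -lx eqseq_cons => /andP[/eqP /noloop].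
Qed.

Lemma cyc_deriv_word_head b i w : is_qpath (i, w) -> last i (map tail w) = i ->
  cyc_deriv_word F b w * pvertex F (head b) = cyc_deriv_word F b w.
Proof.
move=> iw li; rewrite /cyc_deriv_word mulr_suml; apply: eq_bigr => -[n nw] /= /eqP nb.
rewrite pwordM cats0; case: eqP => // /eqP; case/negP.
have ew : w = take n w ++ b :: drop n.+1 w.
  by rewrite -[LHS](cat_take_drop n) (drop_nth b nw) nb.
move: iw li; rewrite [in X in X -> _]ew [in X in _ -> X -> _]ew.
rewrite is_qpath_cat map_cat last_cat /=.
move=> /andP[_]; rewrite /is_qpath /= eqseq_cons => /andP[/eqP hb _] li.
rewrite map_cat last_cat li {}hb.
by case: (take n w).
Qed.

Variable S : PA.
Hypotheses (noloop : no_loops Q) (potS : is_potential S).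

Lemma path_linear_eq_supp (V : lmodType F) (f g : qpath Q -> V) :
  (forall p, p \in msupp S -> f p = g p) -> path_linear f S = path_linear g S.
Proof.
move=> fg; rewrite /path_linear big_seq [RHS]big_seq.
by apply: eq_bigr => p /fg ->.
Qed.

Lemma potential_word p : p \in msupp S ->
  [/\ is_qpath (target p, word p), last (target p) (map tail (word p)) = target p
    & word p <> [::]].
Proof.
move=> /potS[sp wp]; split=> //.
by rewrite /target /word -surjective_pairing (valP p).
Qed.

Lemma fox_cyc_deriv a b :
  fox a (cyc_deriv b S) = if head a == tail b then deriv2 b a S else 0.
Proof.
rewrite /cyc_deriv /deriv2 [path_linear _ _ in LHS]/path_linear linear_sum.
under eq_bigr => p _ do rewrite linearZ /=.
rewrite -/(path_linear (fun p => fox a (cyc_deriv_word F b (word p))) S).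
rewrite (path_linear_eq_supp (g := fun p =>
  if head a == tail b then deriv2_word F b a (word p) else 0)).
  by case: eqP => // _; rewrite /path_linear big1 // => p _; rewrite scaler0.
by move=> p /potential_word[]; exact: fox_cyc_deriv_word.
Qed.

Lemma counit_cyc_deriv k b : counit k (cyc_deriv b S) = 0.
Proof.
rewrite /cyc_deriv /path_linear linear_sum big_seq big1 // => p /potential_word[pw pl _].
by rewrite linearZ /= (counit_cyc_deriv_word k b noloop pw pl) scaler0.
Qed.

Lemma cyc_deriv_head b : cyc_deriv b S * pvertex F (head b) = cyc_deriv b S.
Proof.
rewrite /cyc_deriv [path_linear _ _]/path_linear mulr_suml big_seq [RHS]big_seq.
apply: eq_bigr => p /potential_word[pw pl _].
by rewrite -path_scalerAl (cyc_deriv_word_head b pw pl).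
Qed.

(** This is [fox_expand] for the cyclic derivative: the constant term is zero and the Fox
    derivatives are the second derivatives of [S]. *)
Lemma cyc_deriv_expand b :
  cyc_deriv b S = \sum_(a | head a == tail b) parrow F a * deriv2 b a S.
Proof.
rewrite {1}[cyc_deriv b S]fox_expand big1 => [|k _]; last first.
  by rewrite counit_cyc_deriv scale0r.
rewrite add0r [RHS]big_mkcond; apply: eq_bigr => a _.
by rewrite fox_cyc_deriv; case: eqP; rewrite ?mulr0.
Qed.

End CyclicDerivatives.

(** * Radical filtration *)

(** Project onto [f @: U] along [X], then invert [f] on [U]; composing with [projv U] keeps the
    values in [U]. It is used for [f] equal to [alpha] and to the identity. *)
Lemma linear_section (F : fieldType) (V W : vectType F) (f : 'Hom(V, W))
    (U : {vspace V}) (X : {vspace W}) :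
  (U :&: lker f = 0)%VS -> (X :&: f @: U = 0)%VS ->
  exists s : 'Hom(W, V), [/\ forall w, s w \in U, {in U, cancel f s},
    {in X, forall w, s w = 0}
    & {in (X + f @: U)%VS, forall w, w - f (s w) \in X}].
Proof.
move=> Uf XfU; have fUX : (f @: U :&: X = 0)%VS by rewrite capvC.
pose g := (f \o projv U)%VF; pose s := (projv U \o g^-1 \o daddv_pi (f @: U) X)%VF.
have gU u : u \in U -> g u = f u by move=> uU; rewrite comp_lfunE projv_id.
have sK w : w \in (f @: U)%VS -> f (s w) = w.
  move=> wU; rewrite !comp_lfunE daddv_pi_id // -[LHS](comp_lfunE f) limg_lfunVK //.
  by have /memv_imgP[u uU ->] := wU; rewrite -gU // memv_img // memvf.
have sU w : s w \in U by rewrite !comp_lfunE memv_proj.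
exists s; split=> //.
- move=> u uU; apply/eqP; rewrite -subr_eq0 -memv0 -Uf memv_cap memvB //=.
  by rewrite memv_ker linearB /= sK ?subrr ?memv_img.
- move=> w wX; suff -> : w = daddv_pi X (f @: U) w.
    rewrite !comp_lfunE; suff -> : daddv_pi (f @: U) X (daddv_pi X (f @: U) w) = 0.
      by rewrite !linear0.
    have := daddv_pi_add fUX (subvP (addvSr _ _) w wX).
    by rewrite !(daddv_pi_id XfU) // => /eqP; rewrite -subr_eq0 addrK => /eqP.
  by rewrite daddv_pi_id.
- move=> w; rewrite addvC => wX; rewrite -[X in X - _](daddv_pi_add fUX wX).
  have -> : f (s w) = daddv_pi (f @: U) X w.
    rewrite -[RHS]sK ?memv_pi //; congr (f _); rewrite !comp_lfunE.
    by rewrite daddv_pi_proj.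
  by rewrite addrC addKr memv_pi.
Qed.

Section IdealPowers.
Variable A : pzRingType.
Implicit Types (I : set A) (x y z : A).

Lemma ideal_powMl I n u x : (forall y, I y -> I (u * y)) ->
  ideal_pow I n x -> ideal_pow I n (u * x).
Proof.
case: n => // n Iu; apply: sums_of_map; [exact: mulr0 | exact: mulrDr |].
by move=> _ [y Iy [z Iz ->]]; exists (u * y); [exact: Iu | exists z; rewrite ?mulrA].
Qed.

Lemma ideal_powMr I n u x : (forall y, I y -> I (y * u)) ->
  ideal_pow I n x -> ideal_pow I n (x * u).
Proof.
move=> Iu; elim: n x => // n IH.
apply: (sums_of_map (f := fun x => x * u)); [exact: mul0r | by move=> ? ?; rewrite mulrDl|].
move=> _ [y Iy [z Iz ->]]; exists y => //; exists (z * u); last by rewrite mulrA.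
exact: IH.
Qed.

(** Powers are built by multiplication on the left, while [phi] brings in arrows on the right. *)
Lemma ideal_gen_pow_mulr (G : set A) n x y : ideal_gen G y ->
  ideal_pow (ideal_gen G) n x -> ideal_pow (ideal_gen G) n.+1 (x * y).
Proof.
move=> Gy; elim: n x => [|n IH] x.
  move=> _; apply: sums_of_sub; exists (x * y); first exact: ideal_genMl.
  by exists 1; rewrite ?mulr1.
apply: (sums_of_map (f := fun x => x * y)); [exact: mul0r | by move=> ? ?; rewrite mulrDl|].
move=> _ [u Gu [v Gv ->]]; exists u => //; exists (v * y); last by rewrite mulrA.
exact: IH.
Qed.

Lemma ideal_gen_pow1 (G : set A) x :
  ideal_pow (ideal_gen G) 1 x -> ideal_gen G x.
Proof.
apply: sums_of_ind => [|y z Iy Iz|]; [exact: sums_of0 | exact: sums_ofD|].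
by move=> _ [y Iy [z _ ->]]; exact: ideal_genMr.
Qed.

End IdealPowers.

Section Radical.
Variables (F : fieldType) (Q : quiver) (S : path_algebra F Q).
Local Notation P := (jacobian S).
Local Notation rad n := (ideal_pow (jarrow_ideal S) n).

Lemma jarrow_ideal_lift z :
  jarrow_ideal S z -> exists2 h, @arrow_ideal F Q h & z = jac_proj S h.
Proof.
move: z; apply: sums_of_ind => [|_ _ [h Ih ->] [h' Ih' ->]|].
- by exists 0; [exact: sums_of0 | rewrite raddf0].
- by exists (h + h'); [exact: sums_ofD | rewrite raddfD].
move=> _ [u [_ [a _ <-] [v ->]]].
have [u' ->] := jac_projK u; have [v' ->] := jac_projK v.
exists (u' * parrow F a * v'); last by rewrite !jac_projM.
by apply/ideal_genMr/ideal_genMl/ideal_gen_sub; exists a.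
Qed.

Lemma rad_lift n z :
  rad n z -> exists2 h, ideal_pow (@arrow_ideal F Q) n h & z = jac_proj S h.
Proof.
elim: n z => [|n IH] z; first by have [h ->] := jac_projK z; exists h.
move: z; apply: sums_of_ind => [|_ _ [h Ih ->] [h' Ih' ->]|].
- by exists 0; [exact: sums_of0 | rewrite raddf0].
- by exists (h + h'); [exact: sums_ofD | rewrite raddfD].
move=> _ [_ /jarrow_ideal_lift[u Iu ->] [_ /IH[v Iv ->] ->]].
exists (u * v); last by rewrite jac_projM.
by apply: sums_of_sub; exists u => //; exists v.
Qed.

Definition rad_vanishes n := forall z, rad n z -> z = 0.

(** An element of the n-th power of m lifts to the n-th power of the arrow ideal of the path
    algebra, hence into the Jacobian ideal. *)
Lemma rad_nilpotent n : ideal_pow (@arrow_ideal F Q) n `<=` jacobian_ideal S ->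
  rad_vanishes n.
Proof.
move=> nS _ /rad_lift[h /nS Jh ->]; rewrite -(raddf0 (jac_proj S)).
by apply/jac_proj_eq; rewrite subr0.
Qed.

Lemma radMl n u z : rad n z -> rad n (u * z).
Proof. by apply: ideal_powMl => y; exact: ideal_genMl. Qed.

Lemma rad_arrow n a z : rad n z -> rad n.+1 (z * jarrow a).
Proof. by apply: ideal_gen_pow_mulr; apply: ideal_gen_sub; exists a. Qed.

Lemma radMr n u z : rad n z -> rad n (z * u).
Proof. by apply: ideal_powMr => y; exact: ideal_genMr. Qed.

Lemma jvertexM (i j : vertex Q) :
  jvertex i * jvertex j = if i == j then jvertex i else 0 :> P.
Proof. by rewrite -jac_projM pvertexM; case: eqP => // _; rewrite raddf0. Qed.

Lemma sum_jvertex : \sum_i jvertex i = 1 :> P.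
Proof. by rewrite -raddf_sum. Qed.

Lemma jarrow_tail a : jarrow a * jvertex (tail a) = jarrow a :> P.
Proof. by rewrite -jac_projM parrow_tail. Qed.

Lemma jarrow_head a : jvertex (head a) * jarrow a = jarrow a :> P.
Proof. by rewrite -jac_projM parrow_head. Qed.

Lemma jprojP k p : jproj S k p <-> p * jvertex k = p.
Proof.
split=> [[q ->]|<-]; last by exists p.
by rewrite -mulrA jvertexM eqxx.
Qed.

End Radical.

(** * The radical filtration on direct sums of [P_k (x) V_k] *)

Section RadicalTensors.
Variables (F : fieldType) (Q : quiver) (S : path_algebra F Q).
Local Notation P := (jacobian S).
Local Notation rad n := (ideal_pow (jarrow_ideal S) n).
Implicit Types (k : vertex Q) (c p q : P).

Lemma tens0l (W : vectType F) (w : W) : tens (0 : P) w = 0.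
Proof. by apply: (addIr (tens 0 w)); rewrite -tensDl !add0r. Qed.

Lemma tens0r (W : vectType F) p : tens p (0 : W) = 0.
Proof. by apply: (addIr (tens p 0)); rewrite -tensDr !add0r. Qed.

Lemma ffun_dsum (I : finType) (Z : zmodType) (x : {ffun I -> Z}) :
  x = \sum_i dsum_inj i (x i).
Proof.
apply/ffunP => i; rewrite sum_ffunE (bigD1 i) //= ffunE eqxx big1 ?addr0 //.
by move=> j ji; rewrite ffunE eq_sym (negPf ji).
Qed.

Section OneSpace.
Variable W : vectType F.
Implicit Types (V : vertex Q -> {vspace W}) (w : W) (x y : {ffun vertex Q -> tensor S W}).

(* [rad_tens n V] is the direct sum of the [(m^n e_k) (x) V k]. *)
Definition rad_tens n V : set {ffun vertex Q -> tensor S W} :=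
  [set x | forall k, sums_of [set y | exists2 p, rad n p /\ p * jvertex k = p &
     exists2 w, w \in V k & y = tens p w] (x k)].

Lemma rad_tens0E V : rad_tens 0 V = proj_tens S V.
Proof.
rewrite eqEsubset; split=> x xV k; move: (xV k); apply: (sums_of_map (f := id)) => //.
  by move=> _ [p [_ /jprojP pk] [w wV ->]]; exists p => //; exists w.
by move=> _ [p /jprojP pk [w wV ->]]; exists p => //; exists w.
Qed.

Lemma rad_tens_zero n V : rad_tens n V 0.
Proof. by move=> k; rewrite ffunE; exact: sums_of0. Qed.

Lemma rad_tensD n V x y : rad_tens n V x -> rad_tens n V y -> rad_tens n V (x + y).
Proof. by move=> xV yV k; rewrite ffunE; exact: sums_ofD. Qed.

Lemma rad_tensZ n V c x : rad_tens n V x -> rad_tens n V (c *: x).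
Proof.
move=> xV k; rewrite ffunE; move: (x k) (xV k).
apply: sums_of_map; [exact: scaler0 | exact: scalerDr |].
move=> _ [p [rp pk] [w wV ->]]; exists (c * p).
  by rewrite -mulrA pk; split=> //; exact: radMl.
by exists w; rewrite ?tensMl.
Qed.

Lemma rad_tensN n V x : rad_tens n V x -> rad_tens n V (- x).
Proof. by rewrite -scaleN1r; exact: rad_tensZ. Qed.

Lemma rad_tensB n V x y : rad_tens n V x -> rad_tens n V y -> rad_tens n V (x - y).
Proof. by move=> xV yV; apply: rad_tensD => //; exact: rad_tensN. Qed.

Lemma rad_tens_sum n V (I : Type) (r : seq I) (K : pred I) f :
  (forall i, K i -> rad_tens n V (f i)) -> rad_tens n V (\sum_(i <- r | K i) f i).
Proof.
by move=> fV; elim/big_ind: _ => //; [exact: rad_tens_zero | exact: rad_tensD].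
Qed.

Lemma rad_tens_gen n V k p w : rad n p -> p * jvertex k = p -> w \in V k ->
  rad_tens n V (dsum_inj k (tens p w)).
Proof.
move=> rp pk wV j; rewrite ffunE; case: eqP => [->|_]; last exact: sums_of0.
by apply: sums_of_sub; exists p => //; exists w.
Qed.

Lemma rad_tens_ind n V (K : {ffun vertex Q -> tensor S W} -> Prop) :
  K 0 -> (forall x y, K x -> K y -> K (x + y)) ->
  (forall k p w, rad n p -> p * jvertex k = p -> w \in V k -> K (dsum_inj k (tens p w))) ->
  forall x, rad_tens n V x -> K x.
Proof.
move=> K0 KD KG x xV; rewrite [x]ffun_dsum; elim/big_ind: _ => // k _.
move: (x k) (xV k); apply: sums_of_ind; first by rewrite linear0.
  by move=> y z Ky Kz; rewrite linearD; exact: KD.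
by move=> _ [p [rp pk] [w wV ->]]; exact: KG.
Qed.

Lemma rad_tens_mono m n V V' x : (forall p, rad n p -> rad m p) ->
  (forall k, V k <= V' k)%VS -> rad_tens n V x -> rad_tens m V' x.
Proof.
move=> mn VV'; elim/rad_tens_ind => [|y z|k p w rp pk wV]; first exact: rad_tens_zero.
  exact: rad_tensD.
by apply: rad_tens_gen; [exact: mn | | exact: subvP wV].
Qed.

Lemma rad_tens_split n V V' x : rad_tens n (fun k => V k + V' k)%VS x ->
  exists y z, [/\ rad_tens n V y, rad_tens n V' z & x = y + z].
Proof.
elim/rad_tens_ind => [|_ _ [y [z [yV zV ->]]] [y' [z' [yV' zV' ->]]]|k p w rp pk].
- by exists 0, 0; split; [exact: rad_tens_zero | exact: rad_tens_zero | rewrite addr0].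
- by exists (y + y'), (z + z'); split; [exact: rad_tensD | exact: rad_tensD | rewrite addrACA].
move=> /memv_addP[u uV [v vV ->]]; exists (dsum_inj k (tens p u)), (dsum_inj k (tens p v)).
by split; [exact: rad_tens_gen | exact: rad_tens_gen | rewrite tensDr linearD].
Qed.

Lemma rad_tens_nil n V x : (forall p, rad n p -> p = 0) -> rad_tens n V x -> x = 0.
Proof.
move=> n0; elim/rad_tens_ind => // [y z -> ->|k p w /n0 -> _ _]; first exact: addr0.
by rewrite tens0l linear0.
Qed.

Lemma rad_tens_act n V c x : rad n c -> rad_tens 1 V x -> rad_tens n.+1 V (c *: x).
Proof.
move=> rc; elim/rad_tens_ind => [|y z cy cz|k p w rp pk wV].
- by rewrite scaler0; exact: rad_tens_zero.
- by rewrite scalerDr; exact: rad_tensD.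
rewrite -linearZ /= -tensMl; apply: rad_tens_gen => //; last by rewrite -mulrA pk.
by apply: ideal_gen_pow_mulr => //; exact: ideal_gen_pow1.
Qed.

Lemma rad_tens_act0 n V c x : rad n c -> rad_tens 0 V x -> rad_tens n V (c *: x).
Proof.
move=> rc; elim/rad_tens_ind => [|y z cy cz|k p w rp pk wV].
- by rewrite scaler0; exact: rad_tens_zero.
- by rewrite scalerDr; exact: rad_tensD.
rewrite -linearZ /= -tensMl; apply: rad_tens_gen => //; last by rewrite -mulrA pk.
exact: radMr.
Qed.

End OneSpace.

Section Map.
Variables W W' : vectType F.
Variable g : vertex Q -> 'Hom(W, W').

Definition tens_map (x : {ffun vertex Q -> tensor S W}) : {ffun vertex Q -> tensor S W'} :=
  [ffun k => tens_lift (fun p w => tens p (g k w)) (x k)].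

Lemma tens_map_is_linear : linear tens_map.
Proof.
move=> c x y; apply/ffunP => k; rewrite !ffunE.
apply: (tens_lift_is_linear (g := fun c z => c *: z)) => [d|d p q w]; first exact: scalerDr.
by rewrite tensDl tensMl.
Qed.

Lemma tens_mapD x y : tens_map (x + y) = tens_map x + tens_map y.
Proof. by have := tens_map_is_linear 1 x y; rewrite !scale1r. Qed.

Lemma tens_map0 : tens_map 0 = 0.
Proof. by have := tens_map_is_linear (-1) 0 0; rewrite !scaleN1r !addNr. Qed.

Lemma tens_mapN x : tens_map (- x) = - tens_map x.
Proof. by have := tens_map_is_linear (-1) x 0; rewrite !scaleN1r tens_map0 !addr0. Qed.

Lemma tens_map_gen k p w :
  tens_map (dsum_inj k (tens p w)) = dsum_inj k (tens p (g k w)).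
Proof.
apply/ffunP => j; rewrite !ffunE; case: eqP => [->|_].
  rewrite tens_liftE // => [q u v|c q u]; first by rewrite linearD tensDr.
  by rewrite tensZ linearZ.
by rewrite /tens_lift big1 // => i _; rewrite mxE tens0l.
Qed.

Lemma tens_map_rad n (V : vertex Q -> {vspace W}) (V' : vertex Q -> {vspace W'}) x :
  (forall k w, w \in V k -> g k w \in V' k) ->
  rad_tens n V x -> rad_tens n V' (tens_map x).
Proof.
move=> gV; elim/rad_tens_ind => [|y z|k p w rp pk wV].
- by rewrite tens_map0; exact: rad_tens_zero.
- by rewrite tens_mapD; exact: rad_tensD.
by rewrite tens_map_gen; apply: rad_tens_gen => //; exact: gV.
Qed.

End Map.
End RadicalTensors.

(** * The standard presentation *)

Section ModulePresentation.
Variables (F : fieldType) (Q : quiver) (S : path_algebra F Q).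
Variables (M : vectType F) (act : jac_module S M).
Local Notation P := (jacobian S).
Local Notation AM := {ffun arrow Q -> M}.
Local Notation rad n := (ideal_pow (jarrow_ideal S) n).
Local Notation phi := (phi act).
Local Notation ev := (ev act).
Local Notation alpha := (alpha act).
Local Notation gamma := (gamma act).
Local Notation mspace := (mspace act).
Local Notation m_in := (m_in act).
Implicit Types (k : vertex Q) (a b : arrow Q) (p q : P) (u v : M) (m w : AM).

Lemma actM p q u : act (p * q) u = act p (act q u).
Proof. by rewrite jactM comp_lfunE. Qed.

Lemma mspaceP k u : reflect (act (jvertex k) u = u) (u \in mspace k).
Proof.
apply: (iffP memv_imgP) => [[v _ ->]|<-]; last by exists u; rewrite ?memvf.
by rewrite -actM jvertexM eqxx.
Qed.

Lemma act_vertex_id k u : u \in mspace k -> act (jvertex k) u = u.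
Proof. by move/mspaceP. Qed.

Lemma act_vertex_in k u : act (jvertex k) u \in mspace k.
Proof. by apply/mspaceP; rewrite -actM jvertexM eqxx. Qed.

Lemma act_vertex_neq i k u : i != k -> u \in mspace k -> act (jvertex i) u = 0.
Proof.
move=> ik /act_vertex_id <-; rewrite -actM jvertexM (negPf ik).
by rewrite linear0 lfunE.
Qed.

Lemma sum_act_vertex u : \sum_k act (jvertex k) u = u.
Proof. by rewrite -sum_lfunE -linear_sum sum_jvertex jact1 id_lfunE. Qed.

Lemma act_arrow_in a u : act (jarrow a) u \in mspace (head a).
Proof. by apply/mspaceP; rewrite -actM jarrow_head. Qed.

Lemma m_in_inj a u : u \in mspace (tail a) -> dsum_inj a u \in m_in (head a).
Proof.
move=> uM; rewrite -arr_injE; apply: (subvP (sumv_sup a _ (subvv _))) => //.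
exact: memv_img.
Qed.

Lemma m_inP k m : m \in m_in k ->
  (forall a, head a = k -> m a \in mspace (tail a)) /\
  (forall a, head a != k -> m a = 0).
Proof.
move=> /memv_sumP[f fM ->].
have fE b a : head b == k -> (f b a \in mspace (tail a)) /\ (a != b -> f b a = 0).
  move=> /fM /memv_imgP[u uM ->]; rewrite arr_injE ffunE.
  by case: eqP => [->|_]; rewrite ?mem0v.
split=> a hak; rewrite sum_ffunE.
  by apply: memv_suml => b /(fE b a)[].
rewrite big1 // => b hb; apply: (fE b a hb).2.
by apply: contraNneq hak => ->.
Qed.

Lemma alpha_inj a u : alpha (head a) (dsum_inj a u) = act (jarrow a) u.
Proof.
rewrite alphaE (bigD1 a) //= ffunE eqxx big1 ?addr0 // => b /andP[_ ba].
by rewrite ffunE (negPf ba) linear0.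
Qed.

Lemma alpha_in k m : alpha k m \in mspace k.
Proof.
by rewrite alphaE; apply: memv_suml => a /eqP <-; exact: act_arrow_in.
Qed.

Lemma phiD x y : phi (x + y) = phi x + phi y.
Proof. by have := phi_is_linear act 1 x y; rewrite !scale1r. Qed.

Lemma phi0 : phi 0 = 0.
Proof. by have := phi_is_linear act (-1) 0 0; rewrite !scaleN1r !addNr. Qed.

Lemma phiZ p x : phi (p *: x) = p *: phi x.
Proof. by have := phi_is_linear act p x 0; rewrite phi0 !addr0. Qed.

Lemma phiN x : phi (- x) = - phi x.
Proof. by rewrite -scaleN1r phiZ scaleN1r. Qed.

Lemma phi_sum (I : Type) (r : seq I) (K : pred I) f :
  phi (\sum_(i <- r | K i) f i) = \sum_(i <- r | K i) phi (f i).
Proof. exact: (big_morph _ phiD phi0). Qed.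

Lemma ev_is_zmod : zmod_morphism ev.
Proof.
by move=> x y; rewrite addrC -scaleN1r ev_is_linear addrC linearN jact1 opp_lfunE id_lfunE.
Qed.
HB.instance Definition _ := GRing.isZmodMorphism.Build _ _ ev ev_is_zmod.

Lemma ev_phi x : rad_tens 0 m_in x -> ev (phi x) = 0.
Proof.
elim/rad_tens_ind => [|y z ey ez|k p m _ _ _]; first by rewrite phi0 raddf0.
  by rewrite phiD raddfD /= ey ez addr0.
rewrite phi_tens raddfB raddf_sum /= ev_tens alphaE linear_sum /=.
by rewrite -sumrB big1 // => a _; rewrite ev_tens actM subrr.
Qed.

(** Adding [1 (x) alpha] cancels the second half of [phi]; the remaining terms [p a (x) m_a] have
    gained an arrow. *)
Lemma phi_alpha_rad n x : rad_tens n m_in x ->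
  rad_tens n.+1 mspace (phi x + tens_map alpha x).
Proof.
elim/rad_tens_ind => [|y z Hy Hz|k p m rp pk /m_inP[mM _]].
- by rewrite phi0 tens_map0 addr0; exact: rad_tens_zero.
- by rewrite phiD tens_mapD addrACA; exact: rad_tensD.
rewrite phi_tens tens_map_gen subrK; apply: rad_tens_sum => a /eqP ak.
apply: rad_tens_gen; [exact: rad_arrow | | exact: mM].
by rewrite -mulrA jarrow_tail.
Qed.

(** The tensor [1 (x) u] sorted into the summands; a linear section of [ev]. *)
Definition unit_tens u : {ffun vertex Q -> tensor S M} :=
  \sum_k dsum_inj k (tens (jvertex k) (act (jvertex k) u)).

Lemma unit_tensD u v : unit_tens (u + v) = unit_tens u + unit_tens v.
Proof.
by rewrite -big_split; apply: eq_bigr => k _; rewrite linearD tensDr linearD.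
Qed.

Lemma unit_tens0 : unit_tens 0 = 0.
Proof. by apply: big1 => k _; rewrite linear0 tens0r linear0. Qed.

Lemma unit_tens_in u : rad_tens 0 mspace (unit_tens u).
Proof.
apply: rad_tens_sum => k _; apply: rad_tens_gen => //; last exact: act_vertex_in.
by rewrite jvertexM eqxx.
Qed.

Lemma ev_unit_tens u : ev (unit_tens u) = u.
Proof.
rewrite raddf_sum /= -[RHS]sum_act_vertex; apply: eq_bigr => k _.
by rewrite ev_tens -actM jvertexM eqxx.
Qed.

Lemma unit_tens_vertex k u : u \in mspace k ->
  unit_tens u = dsum_inj k (tens (jvertex k) u).
Proof.
move=> uM; rewrite /unit_tens (bigD1 k) //= act_vertex_id // big1 ?addr0 // => j jk.
by rewrite (act_vertex_neq jk uM) tens0r linear0.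
Qed.

(** Modulo the image of [phi], the tensor [x a (x) u] equals [x (x) a u]; moving the last letter
    repeatedly leaves only trivial paths. *)
Lemma phi_word (h : path_algebra F Q) j u : u \in mspace j ->
  exists2 x, rad_tens 0 m_in x &
    dsum_inj j (tens (jac_proj S h * jvertex j) u) - unit_tens (act (jac_proj S h) u)
    = phi x.
Proof.
elim/path_ind_right: h j u => [i||c x y IH IH'|x a IH] j u uM.
- exists 0; first exact: rad_tens_zero.
  rewrite phi0 -/(jvertex i) jvertexM; case: eqP => [->|/eqP ij].
    by rewrite act_vertex_id // (unit_tens_vertex uM) subrr.
  by rewrite (act_vertex_neq ij uM) unit_tens0 tens0l linear0 subr0.
- exists 0; first exact: rad_tens_zero.
  by rewrite phi0 raddf0 mul0r tens0l !linear0 lfunE unit_tens0 subr0.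
- have [z zM ez] := IH j _ (memvZ c uM); have [z' zM' ez'] := IH' j u uM.
  exists (z + z'); first exact: rad_tensD.
  rewrite phiD -ez -ez' raddfD /= jac_projZ mulrDl -jac_scalerAl tensDl tensZ linearD.
  rewrite linearD add_lfunE /= linearZ scale_lfunE /= unit_tensD linearZ.
  by rewrite opprD addrACA.
have [aj|aj] := eqVneq (tail a) j; last first.
  exists 0; first exact: rad_tens_zero.
  rewrite phi0 jac_projM -/(jarrow a) actM -jarrow_tail actM (act_vertex_neq aj uM).
  by rewrite -2!mulrA jvertexM (negPf aj) !mulr0 !linear0 tens0l linear0 unit_tens0 subrr.
subst j; have [z zM ez] := IH (head a) _ (act_arrow_in a u).
(* On the first summand [phi] gives [x a (x) u - x (x) a u]; [z] accounts for the letters of [x]. *)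
exists (dsum_inj (head a) (tens (jac_proj S x * jvertex (head a)) (dsum_inj a u)) + z).
  apply: rad_tensD => //; apply: rad_tens_gen => //; last exact: m_in_inj.
  by rewrite -mulrA jvertexM eqxx.
rewrite phiD -ez phi_tens alpha_inj jac_projM -/(jarrow a) actM addrA subrK.
congr (_ - _); rewrite (bigD1 a) //= ffunE eqxx big1 ?addr0 => [|b /andP[_ ba]].
  by rewrite -!mulrA jarrow_tail jarrow_head.
by rewrite ffunE (negPf ba) tens0r linear0.
Qed.

(** Modulo the image of [phi] a tensor depends only on its evaluation; in particular [ev y = 0] puts
    [y] into that image. *)
Lemma phi_ker_ev y : rad_tens 0 mspace y ->
  exists2 x, rad_tens 0 m_in x & y - unit_tens (ev y) = phi x.
Proof.
elim/rad_tens_ind => [|y1 y2 [x1 x1M e1] [x2 x2M e2]|k p u _ pk uM].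
- exists 0; first exact: rad_tens_zero.
  by rewrite raddf0 unit_tens0 subr0 phi0.
- exists (x1 + x2); first exact: rad_tensD.
  by rewrite raddfD unit_tensD opprD addrACA e1 e2 phiD.
rewrite ev_tens -[in tens p u]pk; have [h ->] := jac_projK p; exact: phi_word.
Qed.

End ModulePresentation.

(** * The relations of the Jacobian algebra and the map gamma *)

Section GammaPresentation.
Variables (F : fieldType) (Q : quiver) (S : path_algebra F Q).
Variables (M : vectType F) (act : jac_module S M).
Local Notation P := (jacobian S).
Local Notation AM := {ffun arrow Q -> M}.
Local Notation rad n := (ideal_pow (jarrow_ideal S) n).
Local Notation phi := (phi act).
Local Notation ev := (ev act).
Local Notation alpha := (alpha act).
Local Notation gamma := (gamma act).
Local Notation mspace := (mspace act).
Local Notation m_in := (m_in act).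
Local Notation unit_tens := (unit_tens act).
Implicit Types (k : vertex Q) (a b : arrow Q) (p q : P) (u v : M) (m w : AM).

Hypotheses (noloop : no_loops Q) (potS : is_potential S).
Hypothesis gamma_ker : forall k, (im_gamma act k <= ker_alpha act k)%VS.

Lemma gamma_inj b u a : head a = tail b ->
  gamma (tail b) (dsum_inj b u) a = act (jac_proj S (deriv2 b a S)) u.
Proof.
move=> ab; rewrite gammaE sum_ffunE (bigD1 a) ?ab //= [X in _ + X]big1; last first.
  by move=> c /andP[_ ca]; rewrite sum_ffunE big1 // => d _; rewrite ffunE eq_sym (negPf ca).
rewrite addr0 sum_ffunE (bigD1 b) //= [X in _ + X]big1; last first.
  by move=> c /andP[_ cb]; rewrite !ffunE eqxx (negPf cb) linear0.
by rewrite addr0 !ffunE !eqxx.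
Qed.

Lemma jac_cyc_deriv b : jac_proj S (cyc_deriv b S) = 0.
Proof.
rewrite -(raddf0 (jac_proj S)); apply/jac_proj_eq; rewrite subr0.
by apply: ideal_gen_sub; exists b.
Qed.

(* For [n] in [M (head b)], [phi (e_k (x) gamma n)] is the sum of the elements   *)
(* [a (x) deriv2 b a n]; up to [phi (m P_in)] it is [cyc_deriv b S (x) n = 0].   *)
Lemma phi_gamma k w : w \in im_gamma act k ->
  exists2 z, rad_tens 1 m_in z & phi (dsum_inj k (tens (jvertex k) w)) = phi z.
Proof.
move=> /memv_imgP[m /memv_sumP[f fM ->] ->]; rewrite linear_sum.
elim/big_rec: _ => [|b w' /[dup] /fM /memv_imgP[u uM ->] /eqP bk [z' z'M ez']].
  exists 0; first exact: rad_tens_zero.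
  by rewrite tens0r linear0 phi0.
subst k; rewrite arr_injE tensDr linearD phiD ez'.
suff [z zM ->] : exists2 z, rad_tens 1 m_in z & phi (dsum_inj (tail b)
    (tens (jvertex (tail b)) (gamma (tail b) (dsum_inj b u)))) = phi z.
  by exists (z + z'); [exact: rad_tensD | rewrite phiD].
have wg : gamma (tail b) (dsum_inj b u) \in im_gamma act (tail b).
  rewrite memv_img // -arr_injE; apply: (subvP (sumv_sup b _ (subvv _))) => //.
  exact: memv_img.
have := subvP (gamma_ker (tail b)) _ wg.
rewrite memv_cap => /andP[/m_inP[wM _]]; rewrite memv_ker => /eqP w0.
have /fin_all_exists[x xE] : forall a, exists x, rad_tens 0 m_in x /\
    dsum_inj (head b) (tens (jac_proj S (deriv2 b a S) * jvertex (head b)) u)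
    - unit_tens (act (jac_proj S (deriv2 b a S)) u) = phi x.
  by move=> a; have [x] := phi_word (deriv2 b a S) uM; exists x.
(* By [xE], moving the whole of [deriv2 b a S] across the tensor sign costs [phi (x a)]. Multiplying
   by the arrow [a] and summing turns the total cost into an element of m P_in. *)
exists (- \sum_(a | head a == tail b) (jarrow a : P) *: x a).
  apply: rad_tensN; apply: rad_tens_sum => a _; apply: rad_tens_act0 (xE a).1.
  by rewrite -[jarrow a]mul1r; apply: rad_arrow.
have -> : phi (- \sum_(a | head a == tail b) (jarrow a : P) *: x a)
    = - \sum_(a | head a == tail b) (jarrow a : P) *: phi (x a).
  by rewrite phiN phi_sum; congr (- _); apply: eq_bigr => a _; rewrite phiZ.
rewrite phi_tens w0 tens0r linear0 subr0.
apply/eqP; rewrite -subr_eq0 opprK -big_split /=.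
have : \sum_(a | head a == tail b) dsum_inj (head b)
    (tens (jarrow a * jac_proj S (deriv2 b a S) * jvertex (head b)) u) = 0.
  rewrite -linear_sum /= -(big_morph (fun p => tens p u) (fun p q => tensDl p q u)
    (tens0l S u)) -mulr_suml.
  have -> : \sum_(a | head a == tail b) jarrow a * jac_proj S (deriv2 b a S)
      = jac_proj S (cyc_deriv b S).
    rewrite (cyc_deriv_expand noloop potS) raddf_sum; apply: eq_bigr => a _.
    by rewrite -jac_projM.
  by rewrite jac_cyc_deriv mul0r tens0l linear0.
move=> e0; apply/eqP; rewrite -[RHS]e0; apply: eq_bigr => a /eqP ab.
have awM := wM a ab; move: awM; rewrite gamma_inj // => awM.
rewrite -(xE a).2 (unit_tens_vertex awM) scalerBr -!linearZ /= -!tensMl.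
by rewrite jarrow_tail -[in jvertex _ * jarrow a]ab jarrow_head !mulrA addrC subrK.
Qed.

Lemma phi_gamma_rad n k p w : rad n p -> p * jvertex k = p -> w \in im_gamma act k ->
  exists2 z, rad_tens n.+1 m_in z & phi (dsum_inj k (tens p w)) = phi z.
Proof.
move=> rp pk /phi_gamma[z zM ez]; exists (p *: z); first exact: rad_tens_act.
by rewrite phiZ -ez -phiZ -linearZ /= -tensMl pk.
Qed.

End GammaPresentation.

(** * The kernel of [phi] modulo the radical *)

Section FoxAction.
Variables (F : fieldType) (Q : quiver) (S : path_algebra F Q).
Variables (M : vectType F) (act : jac_module S M).
Local Notation P := (jacobian S).
Local Notation PA := (path_algebra F Q).
Local Notation AM := {ffun arrow Q -> M}.
Local Notation phi := (phi act).
Local Notation alpha := (alpha act).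
Local Notation m_in := (m_in act).
Hypotheses (noloop : no_loops Q) (potS : is_potential S).
Implicit Types (k : vertex Q) (a b : arrow Q) (p q : P) (u v : M) (m : AM) (h : PA).

Let jac_projD h h' : jac_proj S (h + h') = jac_proj S h + jac_proj S h'.
Proof. exact: raddfD. Qed.

Let actD p q u : act (p + q) u = act p u + act q u.
Proof. by rewrite linearD add_lfunE. Qed.

Let actZ (c : F) p u : act (c *: p) u = c *: act p u.
Proof. by rewrite linearZ scale_lfunE. Qed.

(** The counit is multiplicative and kills the generators, so it descends to the Jacobian algebra as
    [jcounit]. *)
Lemma counit_jacobian_ideal k h : jacobian_ideal S h -> counit k h = 0.
Proof.
elim/sums_of_ind => [|x y ex ey|_ [u [_ [b _ <-] [v ->]]]]; first exact: linear0.
  by rewrite linearD /= ex ey addr0.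
by rewrite !counitM (counit_cyc_deriv noloop potS) mulr0 mul0r.
Qed.

Definition jcounit k p : F := counit k (repr p).

Lemma jcounitE k h : jcounit k (jac_proj S h) = counit k h.
Proof.
apply/eqP; rewrite -subr_eq0 -linearB; apply/eqP/counit_jacobian_ideal.
exact: repr_quot_proj.
Qed.

Lemma jcounitD k p q : jcounit k (p + q) = jcounit k p + jcounit k q.
Proof.
have [x ->] := jac_projK p; have [y ->] := jac_projK q.
by rewrite -raddfD !jcounitE linearD.
Qed.

Lemma jcounitZ k (c : F) p : jcounit k (c *: p) = c * jcounit k p.
Proof.
by have [x ->] := jac_projK p; rewrite -jac_projZ !jcounitE linearZ.
Qed.

Let famZE (c : F) m a : (c *: m) a = c *: m a.
Proof. by rewrite ffunE. Qed.

Let famDE m m' a : (m + m') a = m a + m' a.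
Proof. by rewrite ffunE. Qed.

Definition fox_act_def k h u : AM :=
  [ffun a => if head a == k then act (jac_proj S (fox a h)) u else 0].
Fact fox_act_key : unit. Proof. exact: tt. Qed.
(* Locked so that unification does not compute with [fox]. *)
Definition fox_act := locked_with fox_act_key fox_act_def.
Canonical fox_act_unlockable := [unlockable fun fox_act].

Lemma fox_actE k h u a :
  fox_act k h u a = if head a == k then act (jac_proj S (fox a h)) u else 0.
Proof. by rewrite unlock ffunE. Qed.

(* The equation [x = _] keeps the sum (product) folded: comparing it with its  *)
(* terms by conversion is very slow.                                            *)
Lemma fox_act_linear k (c : F) h h' x u : x = c *: h + h' ->
  fox_act k x u = c *: fox_act k h u + fox_act k h' u.
Proof.
move=> ex; apply/ffunP => a; rewrite (famDE (c *: _)) famZE !fox_actE.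
case: eqP => _; last by rewrite scaler0 addr0.
have -> : fox a x = c *: fox a h + fox a h' by rewrite ex linearP.
rewrite jac_projD jac_projZ actD actZ.
reflexivity.
Qed.

Lemma fox_act0 k u : fox_act k 0 u = 0.
Proof.
apply/ffunP => a; rewrite fox_actE [RHS]ffunE linear0 raddf0 linear0 lfunE.
by case: eqP.
Qed.

Lemma fox_actD k h h' u : fox_act k (h + h') u = fox_act k h u + fox_act k h' u.
Proof. have e : h + h' = (1 : F) *: h + h' by rewrite scale1r.
by rewrite (fox_act_linear k u e) scale1r. Qed.

Lemma fox_actr_linear k h (c : F) u v w : w = c *: u + v ->
  fox_act k h w = c *: fox_act k h u + fox_act k h v.
Proof.
move=> ew; apply/ffunP => a; rewrite (famDE (c *: _)) famZE !fox_actE.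
case: eqP => _; last by rewrite scaler0 addr0.
by rewrite ew linearP.
Qed.

Lemma fox_actr0 k h : fox_act k h 0 = 0.
Proof. by apply/ffunP => a; rewrite fox_actE [RHS]ffunE linear0; case: eqP. Qed.

Lemma fox_actZ k (c : F) h u : fox_act k (c *: h) u = fox_act k h (c *: u).
Proof.
have e : c *: h = c *: h + 0 by rewrite addr0.
have e' : c *: u = c *: u + 0 by rewrite addr0.
by rewrite (fox_act_linear k u e) fox_act0 (fox_actr_linear k h e') fox_actr0.
Qed.

Lemma fox_actDr k h u v : fox_act k h (u + v) = fox_act k h u + fox_act k h v.
Proof. have e : u + v = (1 : F) *: u + v by rewrite scale1r.
by rewrite (fox_actr_linear k h e) scale1r. Qed.

Lemma fox_actM k h h' x u : x = h * h' -> fox_act k x u =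
  fox_act k h (act (jac_proj S h') u) + counit k h *: fox_act k h' u.
Proof.
move=> ex; apply/ffunP => a; rewrite (famDE (fox_act _ _ _)) famZE !fox_actE.
case: eqP => [<-|_]; last by rewrite scaler0 addr0.
have -> : fox a x = fox a h * h' + counit (head a) h *: fox a h' by rewrite ex foxM.
rewrite jac_projD jac_projZ jac_projM actD actM.
rewrite actZ; reflexivity.
Qed.

Lemma fox_act_arrow k a u : fox_act k (parrow F a) u =
  if head a == k then dsum_inj a (act (jvertex (tail a)) u) else 0.
Proof.
apply/ffunP => c; rewrite fox_actE fox_arrow.
have [ac|ac] := eqVneq a c; first by subst c; case: eqP => _; rewrite ffunE ?eqxx.
rewrite raddf0 linear0 lfunE /=; case: (head a == k); case: (head c == k);
  by rewrite !ffunE // eq_sym (negPf ac).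
Qed.

(** The vector [u] may be replaced by its component [v] at [head b]. For [tail b = k] the family of
    all [deriv2 b a S] applied to [v] is [gamma] of [v] placed in the summand of [b]; otherwise it
    is zero. *)
Lemma fox_act_cyc_deriv k b u :
  fox_act k (cyc_deriv b S) u \in im_gamma act k.
Proof.
rewrite (fox_actM k u (esym (cyc_deriv_head potS b))) (counit_cyc_deriv noloop potS).
rewrite scale0r addr0; set v := act _ u.
have vM : v \in mspace act (head b) by exact: act_vertex_in.
have [bk|bk] := eqVneq (tail b) k; last first.
  suff -> : fox_act k (cyc_deriv b S) v = 0 by exact: mem0v.
  apply/ffunP => a; rewrite fox_actE [RHS]ffunE (fox_cyc_deriv noloop potS).
  case: eqP => // ak; rewrite ak eq_sym (negPf bk) raddf0 linear0 lfunE //.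
subst k; suff -> : fox_act (tail b) (cyc_deriv b S) v = gamma act (tail b) (arr_inj M b v).
  rewrite memv_img //; apply: (subvP (sumv_sup b _ (subvv _))) => //; exact: memv_img.
apply/ffunP => a; rewrite fox_actE arr_injE (fox_cyc_deriv noloop potS).
case: eqP => ab; first by rewrite gamma_inj.
rewrite gammaE sum_ffunE big1 // => c /eqP cb; rewrite sum_ffunE big1 // => d _.
by rewrite ffunE; case: eqP => // ac; case: ab; rewrite ac.
Qed.

(** By the product rule for [x * cyc_deriv b S * y], the term that differentiates [x] vanishes
    because the relation acts as zero, and the term that differentiates [y] vanishes because the
    relation has no constant term. Only the derivative of the relation itself survives. *)
Lemma fox_act_ideal k h u : jacobian_ideal S h -> fox_act k h u \in im_gamma act k.
Proof.
elim/sums_of_ind => [|x y Hx Hy|_ [x [_ [b _ <-] [y ->]]]].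
- by rewrite fox_act0 mem0v.
- by rewrite fox_actD memvD.
rewrite -mulrA (fox_actM k u (erefl _)) jac_projM jac_cyc_deriv mul0r linear0 lfunE.
rewrite fox_actr0 add0r memvZ // (fox_actM k u (erefl _)) (counit_cyc_deriv noloop potS).
rewrite scale0r addr0; exact: fox_act_cyc_deriv.
Qed.

End FoxAction.

(** * Constant terms and stripping the first letter *)

Section Minimality.
Variables (F : fieldType) (Q : quiver) (S : path_algebra F Q).
Variables (M : vectType F) (act : jac_module S M).
Local Notation P := (jacobian S).
Local Notation AM := {ffun arrow Q -> M}.
Local Notation phi := (phi act).
Local Notation alpha := (alpha act).
Local Notation m_in := (m_in act).
Hypotheses (noloop : no_loops Q) (potS : is_potential S).
Implicit Types (a b : arrow Q) (p q : P) (u v : M) (m : AM) (h : path_algebra F Q).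

Lemma tens_liftD (W : vectType F) (Z : zmodType) (f : P -> W -> Z) (x y : tensor S W) :
  (forall p q w, f (p + q) w = f p w + f q w) ->
  tens_lift f (x + y) = tens_lift f x + tens_lift f y.
Proof.
by move=> fD; rewrite -big_split; apply: eq_bigr => i _; rewrite mxE fD.
Qed.

Lemma tens_lift0 (W : vectType F) (Z : zmodType) (f : P -> W -> Z) :
  (forall p q w, f (p + q) w = f p w + f q w) -> tens_lift f (0 : tensor S W) = 0.
Proof.
move=> fD; have := tens_liftD 0 0 fD; rewrite addr0 => /eqP.
by rewrite -subr_eq0 opprD addrA subrr sub0r oppr_eq0 => /eqP.
Qed.

Section Coefficient.
Variable k : vertex Q.

(* The reduction modulo [m] of the [k]-th component. *)
Definition const_tens_def (x : {ffun vertex Q -> tensor S AM}) : AM :=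
  tens_lift (fun p m => jcounit k p *: m) (x k).
Fact const_tens_key : unit. Proof. exact: tt. Qed.
Definition const_tens := locked_with const_tens_key const_tens_def.
Canonical const_tens_unlockable := [unlockable fun const_tens].

Let jcounit_actD p q m : jcounit k (p + q) *: m = jcounit k p *: m + jcounit k q *: m.
Proof. by rewrite (jcounitD noloop potS) scalerDl. Qed.

Lemma const_tensD x y : const_tens (x + y) = const_tens x + const_tens y.
Proof. rewrite unlock ffunE; exact: tens_liftD jcounit_actD. Qed.

Lemma const_tens0 : const_tens 0 = 0.
Proof. rewrite unlock ffunE; exact: tens_lift0 jcounit_actD. Qed.

Lemma const_tens_gen j p m :
  const_tens (dsum_inj j (tens p m)) = if k == j then jcounit k p *: m else 0.
Proof.
rewrite unlock ffunE; case: eqP => _; last exact: tens_lift0 jcounit_actD.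
apply: (tens_liftE (f := fun p m => jcounit k p *: m)) => [q m1 m2|c q m1].
  exact: scalerDr.
by rewrite (jcounitZ noloop potS) scalerA mulrC.
Qed.

Lemma const_tens_in (V : vertex Q -> {vspace AM}) x :
  rad_tens 0 V x -> const_tens x \in V k.
Proof.
elim/rad_tens_ind => [|y z yV zV|j p w _ _ wV]; first by rewrite const_tens0 mem0v.
  by rewrite const_tensD memvD.
by rewrite const_tens_gen; case: eqP => [->|_]; rewrite ?mem0v // memvZ.
Qed.

Variable g : 'Hom(AM, AM).
Hypothesis g_gamma : forall m, m \in im_gamma act k -> g m = 0.

Definition fox_tens_coef p u : AM := g (fox_act act k (repr p) u).

(** Two representatives differ by an element of the Jacobian ideal, whose contribution lies in im
    gamma and is killed by [g]. *)
Lemma fox_tens_coefE h u : fox_tens_coef (jac_proj S h) u = g (fox_act act k h u).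
Proof.
rewrite /fox_tens_coef; set h' := repr _.
have e : h' = (h' - h) + h by rewrite subrK.
have z : g (fox_act act k (h' - h) u) = 0.
  apply: g_gamma; apply: (fox_act_ideal act noloop potS); exact: repr_quot_proj.
rewrite e fox_actD; move: z; move: (fox_act _ _ _ _) => w z.
by rewrite linearD /= z add0r.
Qed.

Let fox_tens_coefD p q u : fox_tens_coef (p + q) u = fox_tens_coef p u + fox_tens_coef q u.
Proof.
have [x ->] := jac_projK p; have [y ->] := jac_projK q.
have -> : jac_proj S x + jac_proj S y = jac_proj S (x + y) by rewrite raddfD.
by rewrite !fox_tens_coefE fox_actD linearD.
Qed.

(* A left inverse of [phi] modulo [m P_in] and [P (x) im gamma]. *)
Definition fox_tens_def (y : {ffun vertex Q -> tensor S M}) : AM :=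
  \sum_j tens_lift fox_tens_coef (y j).
Fact fox_tens_key : unit. Proof. exact: tt. Qed.
Definition fox_tens := locked_with fox_tens_key fox_tens_def.
Canonical fox_tens_unlockable := [unlockable fun fox_tens].

Lemma fox_tensD x y : fox_tens (x + y) = fox_tens x + fox_tens y.
Proof.
rewrite unlock /fox_tens_def -big_split; apply: eq_bigr => j _.
rewrite ffunE; exact: tens_liftD fox_tens_coefD.
Qed.

Lemma fox_tens0 : fox_tens 0 = 0.
Proof.
rewrite unlock; apply: big1 => j _; rewrite ffunE; exact: tens_lift0 fox_tens_coefD.
Qed.

Lemma fox_tensN x : fox_tens (- x) = - fox_tens x.
Proof.
have := fox_tensD (- x) x; rewrite addNr fox_tens0 => /esym /eqP.
by rewrite addr_eq0 => /eqP.
Qed.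

Lemma fox_tens_gen j p u : fox_tens (dsum_inj j (tens p u)) = fox_tens_coef p u.
Proof.
rewrite unlock /fox_tens_def (bigD1 j) //= [X in _ + X]big1 => [|i ij].
  rewrite addr0 ffunE eqxx; have [h ->] := jac_projK p.
  apply: tens_liftE => [q v w|c q v].
    have [x ->] := jac_projK q; rewrite !fox_tens_coefE fox_actDr; exact: linearD.
  have [x ->] := jac_projK q; rewrite -jac_projZ !fox_tens_coefE fox_actZ; reflexivity.
by rewrite ffunE (negPf ij); exact: tens_lift0 fox_tens_coefD.
Qed.

(** On [h (x) m] the product rule splits the derivative of [h a (x) m_a] in two. The parts with [h]
    differentiated add up to the derivative of [h (x) alpha m], which [phi] subtracts; the parts
    with [a] differentiated reassemble the constant term of [h] times [m]. *)
Lemma fox_tens_phi x : rad_tens 0 m_in x -> fox_tens (phi x) = g (const_tens x).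
Proof.
elim/rad_tens_ind => [|y z ey ez|j p m _ _ mM].
- by rewrite phi0 fox_tens0 const_tens0 linear0.
- by rewrite phiD fox_tensD const_tensD linearD ey ez.
have [mM1 mM2] := m_inP mM; have [h ->] := jac_projK p.
rewrite phi_tens const_tens_gen (jcounitE noloop potS) fox_tensD fox_tensN fox_tens_gen.
rewrite (big_morph _ fox_tensD fox_tens0) fox_tens_coefE alphaE.
have -> : fox_act act k h (\sum_(a | head a == j) act (jarrow a) (m a)) =
    \sum_(a | head a == j) fox_act act k h (act (jarrow a) (m a)).
  by apply: (big_morph (fox_act act k h)) => [u v|]; rewrite ?fox_actDr ?fox_actr0.
rewrite linear_sum /= -sumrB.
have -> : (if k == j then counit k h *: m else 0) =
    \sum_(a | head a == j) counit k h *: fox_act act k (parrow F a) (m a).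
  rewrite -scaler_sumr; case: eqP => [->|kj].
    congr (_ *: _); rewrite {1}[m]ffun_dsum (bigID (fun a => head a == j)) /=.
    rewrite [X in _ + X]big1 => [|a ha]; last by rewrite (mM2 _ ha) linear0.
    rewrite addr0; apply: eq_bigr => a /eqP ha.
    by rewrite fox_act_arrow ha eqxx act_vertex_id //; exact: mM1.
  rewrite big1 ?scaler0 // => a /eqP ha; rewrite fox_act_arrow ha.
  by case: eqP => // jk; case: kj.
rewrite linear_sum; apply: eq_bigr => a _; rewrite fox_tens_gen.
rewrite -jac_projM fox_tens_coefE (fox_actM act k (m a) (erefl _)) linearD /=.
by rewrite addrAC subrr add0r.
Qed.
End Coefficient.

Lemma jac_expand p : p = \sum_k jcounit k p *: jvertex k
  + \sum_a jarrow a * jac_proj S (fox a (repr p)).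
Proof.
have [h ep] := jac_projK p; rewrite /jcounit.
have -> : p = jac_proj S (repr p).
  by rewrite ep; apply/esym/jac_proj_eq; exact: repr_quot_proj.
have -> : repr (jac_proj S (repr p)) = repr p.
  by congr (repr _); rewrite ep; apply/jac_proj_eq; exact: repr_quot_proj.
move: (repr p) => {ep}h'; rewrite {1}(fox_expand h') raddfD !raddf_sum /=.
congr (_ + _); apply: eq_bigr => k _; first by rewrite jac_projZ.
by rewrite jac_projM.
Qed.

(** By [jac_expand], an element without its constant term is a sum of arrows times elements, and
    these arrows can be pulled out of the tensor on the left. *)
Lemma const_tens_radical (V : vertex Q -> {vspace AM}) x : rad_tens 0 V x ->
  ideal_act (jarrow_ideal S) (rad_tens 0 V)
    (x - \sum_k dsum_inj k (tens (jvertex k) (const_tens k x))).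
Proof.
elim/rad_tens_ind => [|y z Hy Hz|j p w _ pj wV].
- rewrite big1 => [|k _]; first by rewrite subr0; exact: sums_of0.
  by rewrite const_tens0 tens0r linear0.
- under eq_bigr => k _ do rewrite const_tensD tensDr linearD.
  by rewrite big_split opprD addrACA; exact: sums_ofD.
rewrite (bigD1 j) //= big1 => [|k kj]; last first.
  by rewrite const_tens_gen (negPf kj) tens0r linear0.
rewrite addr0 const_tens_gen eqxx -tensZ.
have -> : dsum_inj j (tens p w) - dsum_inj j (tens (jcounit j p *: jvertex j) w) =
    \sum_a (jarrow a : P) *: dsum_inj j (tens (jac_proj S (fox a (repr p)) * jvertex j) w).
  have ep : p = jcounit j p *: jvertex j
      + \sum_a jarrow a * (jac_proj S (fox a (repr p)) * jvertex j).
    rewrite -{1}pj {1}(jac_expand p) mulrDl !mulr_suml (bigD1 j) //= big1.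
      rewrite addr0 -jac_scalerAl jvertexM eqxx; congr (_ + _).
      by apply: eq_bigr => a _; rewrite mulrA.
    by move=> k kj; rewrite -jac_scalerAl jvertexM (negPf kj) scaler0.
  rewrite {1}ep tensDl linearD /= addrAC subrr add0r.
  rewrite (big_morph (fun p => tens p w) (fun p q => tensDl p q w) (tens0l S w)) linear_sum.
  by apply: eq_bigr => a _; rewrite tensMl linearZ.
elim/big_ind: _ => [|y z|a _]; [exact: sums_of0 | exact: sums_ofD |].
apply: sums_of_sub; exists (jarrow a); first by apply: ideal_gen_sub; exists a.
exists (dsum_inj j (tens (jac_proj S (fox a (repr p)) * jvertex j) w)) => //.
by apply: rad_tens_gen => //; rewrite -mulrA jvertexM eqxx.
Qed.

(** The map [g] fixes the constant term of [x] and kills that of [x2], so the constant term of [x]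
    is [fox_tens] of [phi (x - x2)], that is, zero. *)
Lemma phi_ker_radical (U' U'' : vertex Q -> {vspace AM}) x x2 :
  (forall k, exists g : 'Hom(AM, AM), [/\ forall m, m \in im_gamma act k -> g m = 0,
     forall m, m \in U'' k -> g m = 0 & forall m, m \in U' k -> g m = m]) ->
  (forall k, U' k <= m_in k)%VS -> (forall k, U'' k <= m_in k)%VS ->
  rad_tens 0 U' x -> rad_tens 0 U'' x2 -> phi (x - x2) = 0 ->
  ideal_act (jarrow_ideal S) (rad_tens 0 U') x.
Proof.
move=> gE U'in U''in xU x2U phix.
have c0 k : const_tens k x = 0.
  have [g [g_gamma gU'' gU']] := gE k.
  have xM : rad_tens 0 m_in x by exact: rad_tens_mono xU.
  have x2M : rad_tens 0 m_in x2 by exact: rad_tens_mono x2U.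
  have e : const_tens k x = const_tens k (x - x2) + const_tens k x2.
    by rewrite -const_tensD subrK.
  rewrite -(gU' _ (const_tens_in k xU)) e linearD /= (gU'' _ (const_tens_in k x2U)) addr0.
  by rewrite -(fox_tens_phi g_gamma (rad_tensB xM x2M)) phix fox_tens0.
have := const_tens_radical xU; rewrite big1 ?subr0 // => k _.
by rewrite c0 tens0r linear0.
Qed.

End Minimality.

(** * The minimal presentation *)

Section Splitting.
Variables (F : fieldType) (Q : quiver) (S : path_algebra F Q).
Variables (M : vectType F) (act : jac_module S M).
Local Notation P := (jacobian S).
Local Notation AM := {ffun arrow Q -> M}.
Local Notation rad n := (ideal_pow (jarrow_ideal S) n).
Local Notation phi := (phi act).
Local Notation ev := (ev act).
Local Notation alpha := (alpha act).
Local Notation mspace := (mspace act).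
Local Notation m_in := (m_in act).
Variables (U' U'' : vertex Q -> {vspace AM}) (M0 : vertex Q -> {vspace M}).
Variable N : nat.
Hypotheses (noloop : no_loops Q) (potS : is_potential S).
Hypothesis radN : rad_vanishes S N.
Hypothesis U'_compl : forall k, directv (im_gamma act k + U' k) /\
  (im_gamma act k + U' k)%VS = ker_alpha act k.
Hypothesis U''_compl : forall k, directv (ker_alpha act k + U'' k) /\
  (ker_alpha act k + U'' k)%VS = m_in k.
Hypothesis M0_compl : forall k, directv (M0 k + im_alpha act k) /\
  (M0 k + im_alpha act k)%VS = mspace k.
Implicit Types (k : vertex Q) (x y z : {ffun vertex Q -> tensor S AM}).
Local Notation phib := (phibar act U'' M0).
Local Notation ker := (ker_alpha act).

Local Opaque Defs.phi tens_map rad_tens.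

Lemma U''_sub k : (U'' k <= m_in k)%VS.
Proof. by rewrite -(U''_compl k).2 addvSr. Qed.

Lemma ker_alpha_sub k : (ker k <= m_in k)%VS.
Proof. by rewrite -(U''_compl k).2 addvSl. Qed.

Lemma im_gamma_sub k : (im_gamma act k <= ker k)%VS.
Proof. by rewrite -(U'_compl k).2 addvSl. Qed.

Lemma U'_sub k : (U' k <= ker k)%VS.
Proof. by rewrite -(U'_compl k).2 addvSr. Qed.

Lemma alpha_U'' k : (U'' k :&: lker (alpha k) = 0)%VS.
Proof.
apply/eqP; rewrite -subv0; have /directv_addP <- := (U''_compl k).1.
rewrite /ker_alpha subv_cap capvSl andbT subv_cap capvSr.
by rewrite (subv_trans (capvSl _ _) (U''_sub k)).
Qed.

Lemma im_alphaE k : im_alpha act k = (alpha k @: U'' k)%VS.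
Proof.
rewrite /im_alpha -(U''_compl k).2 limgD.
suff -> : (alpha k @: ker k = 0)%VS by rewrite add0v.
by apply/eqP; rewrite -lkerE capvSr.
Qed.

Lemma alpha_section : exists s : vertex Q -> 'Hom(M, AM), forall k,
  [/\ forall w, s k w \in U'' k, {in U'' k, cancel (alpha k) (s k)},
    {in M0 k, forall w, s k w = 0}
    & {in mspace k, forall w, w - alpha k (s k w) \in M0 k}].
Proof.
have : forall k, exists s : 'Hom(M, AM),
  [/\ forall w, s w \in U'' k, {in U'' k, cancel (alpha k) s},
    {in M0 k, forall w, s w = 0}
    & {in mspace k, forall w, w - alpha k (s w) \in M0 k}].
  move=> k; have [/directv_addP dM eM] := M0_compl k; rewrite im_alphaE in dM eM.
  by have [s] := linear_section (alpha_U'' k) dM; rewrite eM; exists s.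
by move/fin_all_exists.
Qed.

(** The section [s] of [alpha] kills [phi x], whence [x] is [s] applied to [phi x + alpha x]. This
    has one degree more than [x], and the degree climbs up to [N]. *)
Lemma correction_unique x :
  rad_tens 0 U'' x -> rad_tens 0 M0 (phi x) -> x = 0.
Proof.
have [s sE] := alpha_section => xU xM.
apply: (rad_tens_nil radN (V := U'')); elim: N => // n IH.
have : tens_map s (phi x) = 0.
  move: xM; elim/rad_tens_ind => [|y z ey ez|k p w _ _ wM].
  - exact: tens_map0.
  - by rewrite tens_mapD ey ez addr0.
  by rewrite tens_map_gen; have [_ _ -> //] := sE k; rewrite tens0r linear0.
have -> : phi x = (phi x + tens_map alpha x) - tens_map alpha x by rewrite addrK.
have sK : tens_map s (tens_map alpha x) = x.
  elim/rad_tens_ind: xU {IH xM} => [|y z ey ez|k p w _ _ wU].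
  - by rewrite !tens_map0.
  - by rewrite !tens_mapD ey ez.
  by rewrite !tens_map_gen; have [_ -> //] := sE k.
rewrite tens_mapD tens_mapN sK => /eqP; rewrite subr_eq0 => /eqP <-.
apply: (tens_map_rad (V := mspace)) => [k w _|]; first by have [] := sE k.
by apply: phi_alpha_rad; apply: rad_tens_mono IH => // k; exact: U''_sub.
Qed.

(** Subtracting the image of [- s y] from [y] leaves an element of P0 plus an error one degree
    deeper, which is corrected in turn. *)
Lemma correction_exists (y : {ffun vertex Q -> tensor S M}) : rad_tens 0 mspace y ->
  exists2 x, rad_tens 0 U'' x & rad_tens 0 M0 (y - phi x).
Proof.
have [s sE] := alpha_section; rewrite -{1}(subnn N).
(* The degree [0 = N - N] is generalised to [N - i], so that the base case is degree [N], where
   tensors vanish. *)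
move: {1 4}N (leqnn N) => i; elim: i y => [|i IH] y iN.
  rewrite subn0 => /(rad_tens_nil radN) ->.
  by exists 0; [exact: rad_tens_zero | rewrite phi0 subr0; exact: rad_tens_zero].
move=> yM; pose x := - tens_map s y.
have xU n : rad_tens n mspace y -> rad_tens n U'' x.
  by move=> yn; apply/rad_tensN/(tens_map_rad _ yn) => k w _; have [] := sE k.
have [z zU zM] : exists2 z, rad_tens 0 U'' z &
    rad_tens 0 M0 (- (phi x + tens_map alpha x) - phi z).
  apply: IH; first exact: ltnW.
  rewrite -subnSK //; apply/rad_tensN/phi_alpha_rad.
  by apply: rad_tens_mono (xU _ yM) => // k; exact: U''_sub.
exists (x + z); first by apply: rad_tensD => //; apply: xU; exact: rad_tens_mono yM.
(* The first bracket lies in P0 by the choice of [s], the second by the choice of [z]. *)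
have -> : y - phi (x + z) = (y + tens_map alpha x) + (- (phi x + tens_map alpha x) - phi z).
  by rewrite phiD opprD addrA [in RHS]addrA [- (_ + _)]opprD [- phi x + _]addrC addrA addrK.
apply: rad_tensD => //; rewrite /x.
elim/rad_tens_ind: yM {zM IH} => [|y1 y2 e1 e2|k p w _ pk wM].
- by rewrite tens_map0 oppr0 tens_map0 addr0; exact: rad_tens_zero.
- rewrite tens_mapD opprD tens_mapD addrACA; exact (rad_tensD e1 e2).
rewrite tens_mapN !tens_map_gen -linearB /=.
have -> : tens p w - tens p (alpha k (s k w)) = tens p (w - alpha k (s k w)).
  by apply/eqP; rewrite subr_eq -tensDr subrK.
by apply: rad_tens_gen => //; have [_ _ _ ->] := sE k.
Qed.

(** A correction exists, so the default value of [xget] does not occur, and by uniqueness the chosen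
    correction is [x2]. *)
Lemma phibarE x x2 : rad_tens 0 U'' x2 -> rad_tens 0 M0 (phi (x - x2)) ->
  phib x = phi (x - x2).
Proof.
move=> x2U x2M; rewrite /phibar /correction; case: xgetP => [x3 _ []|/(_ x2) []].
  rewrite -!rad_tens0E => x3U x3M; congr (phi (x - _)); apply/eqP.
  rewrite -subr_eq0; apply/eqP/correction_unique; first exact: rad_tensB.
  have -> : x3 - x2 = (x - x2) - (x - x3) by rewrite opprB [RHS]addrC addrA subrK.
  by rewrite phiD phiN; exact: rad_tensB.
by split; rewrite -rad_tens0E.
Qed.

Lemma phibarP x : rad_tens 0 m_in x -> exists2 x2, rad_tens 0 U'' x2 &
  phib x = phi (x - x2) /\ rad_tens 0 M0 (phib x).
Proof.
move=> xM; have phixM : rad_tens 0 mspace (phi x).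
  have -> : phi x = (phi x + tens_map alpha x) - tens_map alpha x by rewrite addrK.
  apply: rad_tensB; first by apply: rad_tens_mono (phi_alpha_rad xM).
  by apply: tens_map_rad xM => k w _; exact: alpha_in.
have [x2 x2U x2M] := correction_exists phixM.
rewrite -phiN -phiD in x2M; exists x2; first exact: x2U.
by split; [exact: phibarE | rewrite (phibarE x2U x2M)].
Qed.

Local Opaque phibar.

Lemma phibar_linear (c : P) x y : rad_tens 0 m_in x -> rad_tens 0 m_in y ->
  phib (c *: x + y) = c *: phib x + phib y.
Proof.
move=> /phibarP[x2 x2U [ex xM]] /phibarP[y2 y2U [ey yM]].
have e : c *: phib x + phib y = phi (c *: x + y - (c *: x2 + y2)).
  rewrite ex ey -phiZ -phiD scalerBr addrACA -opprD; reflexivity.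
rewrite e; apply: phibarE; first exact (rad_tensD (rad_tensZ c x2U) y2U).
rewrite -e; exact (rad_tensD (rad_tensZ c xM) yM).
Qed.

Lemma phibar0 : phib 0 = 0.
Proof.
have z : rad_tens 0 m_in (0 : {ffun vertex Q -> tensor S AM}) by exact: rad_tens_zero.
by have := phibar_linear (-1) z z; rewrite !scaleN1r !addNr.
Qed.

Lemma phibarD x y : rad_tens 0 m_in x -> rad_tens 0 m_in y ->
  phib (x + y) = phib x + phib y.
Proof. by move=> xM yM; have := phibar_linear 1 xM yM; rewrite !scale1r. Qed.

Lemma phibarZ (c : P) x : rad_tens 0 m_in x -> phib (c *: x) = c *: phib x.
Proof.
by move=> xM; have := phibar_linear c xM (rad_tens_zero S 0 m_in); rewrite phibar0 !addr0.
Qed.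

Lemma phibarB x y : rad_tens 0 m_in x -> rad_tens 0 m_in y ->
  phib (x - y) = phib x - phib y.
Proof.
by move=> xM yM; rewrite (phibarD xM (rad_tensN yM)) -[- y]scaleN1r (phibarZ _ yM) scaleN1r.
Qed.

Lemma rad_tens_ker_in n x : rad_tens n ker x -> rad_tens 0 m_in x.
Proof. by apply: rad_tens_mono => // k; exact: ker_alpha_sub. Qed.

Lemma rad_tens_U'_in x : rad_tens 0 U' x -> rad_tens 0 m_in x.
Proof. by move/(rad_tens_mono (fun _ p0 => p0) U'_sub)/rad_tens_ker_in. Qed.

(** Split [z] along M_in = ker alpha + U''; the part in U'' serves, up to sign, as the
    correction. *)
Lemma phibar_lift n z : rad_tens n m_in z -> exists2 y, rad_tens n ker y &
  forall x, rad_tens 0 M0 (phi (x + z)) -> phib (x + y) = phi (x + z).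
Proof.
move=> zM; have : rad_tens n (fun k => ker k + U'' k)%VS z.
  by apply: rad_tens_mono zM => // k; rewrite (U''_compl k).2.
move=> /rad_tens_split[y [t [yK tU ->]]]; exists y; first exact yK.
move=> x; rewrite addrA -[t]opprK; apply: phibarE.
by apply: rad_tensN; apply: rad_tens_mono tU.
Qed.

(** The part of [x] in im gamma is traded through [phi_gamma_rad] for some [z] one degree deeper,
    and [phibar_lift] brings [z] back into P'. *)
Lemma phibar_ker_step n x : rad_tens n ker x -> exists x1 x2,
  [/\ rad_tens 0 U' x1, rad_tens n.+1 ker x2 & phib x = phib x1 + phib x2].
Proof.
(* Membership of [x] is carried through the induction, since [phibarD] asks for it. *)
suff H : rad_tens n ker x -> exists x1 x2,
    [/\ rad_tens 0 U' x1, rad_tens n.+1 ker x2 & phib x = phib x1 + phib x2]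
    /\ rad_tens n ker x by move=> /H[x1 [x2 [H12 _]]]; exists x1, x2.
elim/rad_tens_ind => [|y z [y1 [y2 [[y1U y2K ey] yK]]]
    [z1 [z2 [[z1U z2K ez] zK]]]|k p w rp pk wK].
- exists 0, 0; rewrite phibar0 addr0.
  by split; [split|]; rewrite ?phibar0 //; exact: rad_tens_zero.
- exists (y1 + z1), (y2 + z2); split; last exact: rad_tensD.
  split; [exact: rad_tensD | exact: rad_tensD |].
  rewrite (phibarD (rad_tens_ker_in yK) (rad_tens_ker_in zK)) ey ez.
  rewrite (phibarD (rad_tens_U'_in y1U) (rad_tens_U'_in z1U)).
  rewrite (phibarD (rad_tens_ker_in y2K) (rad_tens_ker_in z2K)).
  exact (addrACA _ _ _ _).
have /memv_addP[u ug [v vU ew]] : w \in (im_gamma act k + U' k)%VS by rewrite (U'_compl k).2.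
have [z zM ez] := phi_gamma_rad noloop potS im_gamma_sub rp pk ug.
have [y yK yE] := phibar_lift zM.
set du := dsum_inj k (tens p u) in ez *; pose dv := dsum_inj k (tens p v).
have duK : rad_tens 0 ker du.
  by apply: rad_tens_gen => //; exact: subvP (im_gamma_sub k) _ ug.
have dvU : rad_tens 0 U' dv by exact: rad_tens_gen.
exists dv, y; split; last exact: rad_tens_gen.
split; [exact dvU | exact yK |]; rewrite ew tensDr linearD -/du -/dv.
have e0 : phi (- du + z) = 0 by rewrite phiD phiN ez addNr.
(* Apply [phibar_lift] to [- du + z], which [phi] sends to zero, an element of P0. *)
have edu : phib y - phib du = 0.
  have := yE (- du); rewrite e0 => /(_ (rad_tens_zero S 0 M0)).
  by rewrite (addrC (- du)) (phibarB (rad_tens_ker_in yK) (rad_tens_ker_in duK)).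
rewrite (phibarD (rad_tens_ker_in duK) (rad_tens_U'_in dvU)) -(subr0_eq edu).
exact (addrC _ _).
Qed.

(* Nakayama's lemma for [phib P1] inside [phib P']. *)
Lemma phibar_ker x : rad_tens 0 ker x ->
  exists2 x1, rad_tens 0 U' x1 & phib x = phib x1.
Proof.
rewrite -{1}(subnn N); move: {1 4}N (leqnn N) => i; elim: i x => [|i IH] x iN.
  rewrite subn0 => /(rad_tens_nil radN) ->.
  by exists 0 => //; exact: rad_tens_zero.
move=> /phibar_ker_step[x1 [x2 [x1U x2K ->]]]; rewrite subnSK // in x2K.
have [x3 x3U ->] := IH _ (ltnW iN) x2K.
by exists (x1 + x3); [exact: rad_tensD | rewrite phibarD //; exact: rad_tens_U'_in].
Qed.


(** If [ev y = 0] then [y = phi x] for some [x] in P_in; [phibar_lift] replaces [x] by an element of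
    P', and [phibar_ker] replaces that by one of P1. *)
Lemma im_phibar : phib @` rad_tens 0 U' = rad_tens 0 M0 `&` [set y | ev y = 0].
Proof.
rewrite eqEsubset; split=> [_ [x xU <-]|y [yM evy]].
  have xM := rad_tens_U'_in xU.
  have [x2 x2U [e P0]] := phibarP xM; split; first exact P0.
  rewrite /= e; apply: ev_phi; apply: (rad_tensB xM).
  exact (rad_tens_mono (fun _ p0 => p0) U''_sub x2U).
have yM' : rad_tens 0 mspace y.
  by apply: rad_tens_mono yM => // k; rewrite -(M0_compl k).2 addvSl.
have [x xM] := phi_ker_ev yM'; rewrite evy unit_tens0 subr0 => ey.
have [x1 x1K x1E] := phibar_lift xM.
have [x2 x2U e] := phibar_ker x1K; exists x2; first exact x2U.
by have := x1E 0; rewrite !add0r -ey -e => ->.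
Qed.

(** Correcting [unit_tens act u] into P0 changes it by an element of the image of [phi], on which
    [ev] vanishes. *)
Lemma ev_surj : ev @` rad_tens 0 M0 = setT.
Proof.
rewrite eqEsubset; split=> // u _.
have [x xU xM] := correction_exists (unit_tens_in act u).
exists (unit_tens act u - phi x); first exact xM.
rewrite raddfB /= ev_unit_tens ev_phi ?subr0 //.
exact (rad_tens_mono (fun _ p0 => p0) U''_sub xU).
Qed.

(** M_in is the direct sum of im gamma, U' and U''. On it [g] is the projection onto U', obtained
    from [linear_section] for the identity map. *)
Lemma U'_retraction k : exists g : 'Hom(AM, AM),
  [/\ forall m, m \in im_gamma act k -> g m = 0,
     forall m, m \in U'' k -> g m = 0 & forall m, m \in U' k -> g m = m].
Proof.
have lker1 : (U' k :&: lker (\1 : 'End(AM)) = 0)%VS.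
  apply/eqP; rewrite -subv0; apply/subvP => v; rewrite memv_cap memv_ker => /andP[_].
  by rewrite id_lfunE memv0.
have dir : ((im_gamma act k + U'' k) :&: (\1%VF @: U' k) = 0)%VS.
  rewrite lim1g; apply/eqP; rewrite -subv0; apply/subvP => v.
  rewrite memv_cap => /andP[/memv_addP[a aG [b bU ->]] vU'].
  have aK := subvP (im_gamma_sub k) _ aG; have vK := subvP (U'_sub k) _ vU'.
  (* Both [a] and [a + b] lie in ker alpha, so [b] lies in its intersection with U''. *)
  have b0 : b = 0.
    apply/eqP; rewrite -memv0; have /directv_addP <- := (U''_compl k).1.
    by rewrite memv_cap bU andbT -(addKr a b) addrC memvB.
  move: vU'; rewrite b0 addr0 => aU'.
  by have /directv_addP <- := (U'_compl k).1; rewrite memv_cap aG.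
have [g [_ gU' gX _]] := linear_section lker1 dir; exists g; split=> m mV.
- by apply: gX; exact: subvP (addvSl _ _) _ mV.
- by apply: gX; exact: subvP (addvSr _ _) _ mV.
by have := gU' m mV; rewrite id_lfunE.
Qed.

Lemma phibar_ideal_act x : ideal_act (jarrow_ideal S) (rad_tens 0 U') x ->
  rad_tens 0 U' x /\ ideal_act (jarrow_ideal S) (phib @` rad_tens 0 U') (phib x).
Proof.
elim/sums_of_ind => [|y z [yU Hy] [zU Hz]|_ [c Ic [y yU ->]]].
- by split; [exact: rad_tens_zero | rewrite phibar0; exact: sums_of0].
- split; first exact (rad_tensD yU zU).
  rewrite (phibarD (rad_tens_U'_in yU) (rad_tens_U'_in zU)); exact (sums_ofD Hy Hz).
split; first exact (rad_tensZ c yU).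
rewrite (phibarZ c (rad_tens_U'_in yU)); apply: sums_of_sub; exists c; first exact Ic.
by exists (phib y); first exists y.
Qed.

Lemma phibar_ideal_act_lift (y : {ffun vertex Q -> tensor S M}) :
  ideal_act (jarrow_ideal S) (phib @` rad_tens 0 U') y ->
  exists2 x, ideal_act (jarrow_ideal S) (rad_tens 0 U') x & phib x = y.
Proof.
elim/sums_of_ind => [|_ _ [x Ix <-] [x' Ix' <-]|_ [c Ic [_ [x xU <-] ->]]].
- by exists 0; [exact: sums_of0 | exact: phibar0].
- exists (x + x'); first exact (sums_ofD Ix Ix').
  exact (phibarD (rad_tens_U'_in (phibar_ideal_act Ix).1) (rad_tens_U'_in (phibar_ideal_act Ix').1)).
exists (c *: x); last exact (phibarZ c (rad_tens_U'_in xU)).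
by apply: sums_of_sub; exists c; [exact Ic | exists x].
Qed.

(** For injectivity, choose [y] in m P1 with the same image as [x]; then [phibar] kills [x - y], and
    [phi_ker_radical] puts this difference into m P1. *)
Lemma phibar_iso : induces_iso phib (rad_tens 0 U')
  (ideal_act (jarrow_ideal S) (rad_tens 0 U')) (phib @` rad_tens 0 U')
  (ideal_act (jarrow_ideal S) (phib @` rad_tens 0 U')).
Proof.
split=> [//|_ [x /phibar_ideal_act[_ Hx] <-]|x xU /phibar_ideal_act_lift[y Iy exy]|].
- exact Hx.
- have yU := (phibar_ideal_act Iy).1; have xyU := rad_tensB xU yU.
  have [x2 x2U [e _]] := phibarP (rad_tens_U'_in xyU).
  have e0 : phi (x - y - x2) = 0.
    by rewrite -e (phibarB (rad_tens_U'_in xU) (rad_tens_U'_in yU)) exy subrr.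
  have := phi_ker_radical noloop potS U'_retraction
    (fun k => subv_trans (U'_sub k) (ker_alpha_sub k)) U''_sub xyU x2U e0.
  by move=> Ixy; rewrite -(subrK y x); exact (sums_ofD Ixy Iy).
- by move=> _ [x xU <-]; exists x; [exact xU | rewrite subrr; exact: sums_of0].
Qed.


Lemma minimal_presentation :
  let P' := proj_tens S ker in
  let P'' := proj_tens S U'' in
  let P1 := proj_tens S U' in
  let P0 := proj_tens S M0 in
  let J := jarrow_ideal S in
  [/\ [/\ forall x, P' x -> exists! x2, P'' x2 /\ P0 (phi (x - x2)),
      forall x, P' x -> exists2 x2, P'' x2 & phib x = phi (x - x2) /\ P0 (phib x)
      & forall (c : P) x y, P' x -> P' y -> phib (c *: x + y) = c *: phib x + phib y],
      phib @` P1 = P0 `&` [set y | ev y = 0] /\ ev @` P0 = setT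
    & induces_iso phib P1 (ideal_act J P1) (phib @` P1) (ideal_act J (phib @` P1))].
Proof.
rewrite /= -!rad_tens0E; split.
- split=> [x xK|x xK|c x y xK yK].
  + have [x2 x2U [e P0x]] := phibarP (rad_tens_ker_in xK); rewrite e in P0x.
    exists x2; split; first by split; [exact x2U | exact P0x].
    move=> x3 [x3U P0x3]; apply/subr0_eq.
    apply: correction_unique; first exact (rad_tensB x2U x3U).
    have -> : x2 - x3 = (x - x3) - (x - x2) by rewrite opprB [RHS]addrC addrA subrK.
    by rewrite phiD phiN; exact (rad_tensB P0x3 P0x).
  + exact (phibarP (rad_tens_ker_in xK)).
  + exact (phibar_linear c (rad_tens_ker_in xK) (rad_tens_ker_in yK)).
- exact (conj im_phibar ev_surj).
- exact phibar_iso.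
Qed.

End Splitting.

Unset Implicit Arguments.

Theorem proposition10p4 (R : realType) (Q : quiver) (S : path_algebra R[i] Q)
    (M : vectType R[i]) (act : jac_module S M)
    (U' U'' : vertex Q -> {vspace {ffun arrow Q -> M}})
    (M0 : vertex Q -> {vspace M})
    (noloops : no_loops Q) (no2cycles : no_2cycles Q)
    (potS : is_potential S)
    (admissible : exists N, ideal_pow (@arrow_ideal R[i] Q) N `<=` jacobian_ideal S)
    (U'_compl : forall k, directv (im_gamma act k + U' k) /\
       (im_gamma act k + U' k)%VS = ker_alpha act k)
    (U''_compl : forall k, directv (ker_alpha act k + U'' k) /\
       (ker_alpha act k + U'' k)%VS = m_in act k)
    (M0_compl : forall k, directv (M0 k + im_alpha act k) /\
       (M0 k + im_alpha act k)%VS = mspace act k) :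
  let P' := proj_tens S (ker_alpha act) in
  let P'' := proj_tens S U'' in
  let P1 := proj_tens S U' in
  let P0 := proj_tens S M0 in
  let phib := phibar act U'' M0 in
  let m := jarrow_ideal S in
  [/\ [/\ forall x, P' x -> exists! x2, P'' x2 /\ P0 (phi act (x - x2)),
      forall x, P' x ->
        exists2 x2, P'' x2 & phib x = phi act (x - x2) /\ P0 (phib x)
      & forall (c : jacobian S) x y, P' x -> P' y ->
        phib (c *: x + y) = c *: phib x + phib y],
      phib @` P1 = P0 `&` [set y | ev act y = 0] /\ ev act @` P0 = setT
    & induces_iso phib P1 (ideal_act m P1)
        (phib @` P1) (ideal_act m (phib @` P1))].
Proof.
have [N /rad_nilpotent radN] := admissible.
exact (minimal_presentation noloops potS radN U'_compl U''_compl M0_compl).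
Qed.
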